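(* Let $K$ be an oriented, non-split link with a special alternating diagram $D$ (an alternating diagram all of whose crossings are positive), and suppose the symmetrized Alexander polynomial of $K$ is $$\Delta_K(t)=\sum_{i=-n}^{n}a_it^{i/2}$$ for some $n\ge 0$ and integers $a_{-n},a_{1-n},\dots,a_n$. Let $\sigma(K)$ be the signature of $K$ and $P_K$ the polynomial defined in the context. Then $$P_K(x,y,z,w)=P_K(x,y,1,1)=x^{\sigma(K)/2}y^{\sigma(K)/2}\sum_{i=-n}^{n}|a_i|\,x^{i/2}y^{-i/2}.$$
   Context: Alexander polynomial and signature. For a Seifert matrix $V$ of $K$, $\Delta_K(t)=\det(t^{1/2}V-t^{-1/2}V^{\top})\in\mathbb{Z}[t^{1/2},t^{-1/2}]$, regarded as defined only up to sign, and $\sigma(K)$ is the signature of $V+V^{\top}$, with the convention that the trefoil with positive crossings has signature $-2$. All links are oriented and non-split. A link is alternating if it has a diagram in which each component alternates between over- and undercrossings (an alternating diagram). Crossing signs: rotate the picture so both strands point upward; the crossing is positive if the overstrand runs from lower left to upper right, negative if it runs from lower right to upper left. Tait digraph. Let $D\subset\mathbb{R}^2$ be an alternating diagram of a non-split link. Regions of $D$ are the components of the complement of the underlying 4-valent plane graph. Choose the checkerboard shading of the regions such that at every crossing, when the picture is rotated so that the overstrand runs from lower left to upper right, the top and bottom regions are the shaded ones. The Tait digraph $G=(V,E)$ is the plane digraph with one vertex in each shaded region and one edge through each crossing, joining the vertices of the two shaded regions at that crossing (loops and multiple edges allowed), directed to match the overcrossing: rotating so that the overstrand is directed from lower left to upper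 right, the edge points from the bottom region to the top region. An edge is positive or negative according to the sign of its crossing; $E=E_+\sqcup E_-$. Activities. Fix a root vertex $r\in V$ and a basepoint $q\in\mathbb{R}^2\setminus G$. Let $T$ be a spanning tree of $G$ (viewed as a set of edges). An edge $e\in T$ is internally semi-active if it points away from the component of $T\setminus\{e\}$ containing $r$, and internally semi-passive otherwise. For $e\in E\setminus T$, let $\mathrm{Cyc}_T(e)$ be the unique cycle in $T\cup\{e\}$, oriented counter-clockwise around $q$ in $\mathbb{R}^2\cup\{\infty\}$ (so that the side containing $q$ lies on its left); $e$ is externally semi-active if its direction agrees with this orientation, and externally semi-passive otherwise. Let $\iota_+(T)$, $\overline{\iota}_+(T)$ be the numbers of internally semi-active, respectively semi-passive, edges in $T\cap E_+$, and $\varepsilon_-(T)$, $\overline{\varepsilon}_-(T)$ the numbers of externally semi-active, respectively semi-passive, edges in $E_-\setminus T$. The polynomial. For an alternating diagram $D$ of $K$ with Tait digraph $G$, a root $r$, and a basepoint $q$ in a face of $G$ adjacent to $r$ (its boundary contains $r$), $$P_K(x,y,z,w)=\sum_{T}x^{-\iota_+(T)}y^{-\overline{\iota}_+(T)}z^{\varepsilon_-(T)}w^{\overline{\varepsilon}_-(T)},$$ summed over all spanning trees $T$ of $G$. It does not depend on the choice of alternating diagram or of adjacent pair $(r,q)$. *)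

(* Defs.v *)
From HB Require Import structures.
From mathcomp Require Import all_boot all_order all_algebra all_field.
From mathcomp.multinomials Require Import mpoly.

Set Implicit Arguments.
Unset Strict Implicit.
Unset Printing Implicit Defensive.

Import Order.TTheory GRing.Theory Num.Theory.
Local Open Scope ring_scope.

(** * Oriented link diagrams on the sphere

  A diagram is recorded as a signed Gauss code.  A strand end at a crossing
  is a pair [(c, b)], with [b = true] for the overstrand and [b = false] for
  the understrand.  [inn (c, b)] is the oriented arc arriving at [c] along
  that strand and [out (c, b)] the arc leaving [c] along it.  An arc outside
  the (common) image of [inn] and [out] is a crossingless closed curve; such
  arcs are allowed so that the round circle is a diagram of the unknot.

  With both strands of a crossing drawn pointing upward, the overstrand runs
  from lower left to upper right when the crossing is positive, and from
  lower right to upper left when it is negative. *)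
Record link_diagram := LinkDiagram {
  crossing : finType;
  arc : finType;
  positive : pred crossing;
  inn : crossing * bool -> arc;
  out : crossing * bool -> arc;
  inn_inj : injective inn;
  out_inj : injective out;
  inn_out : codom inn =i codom out
}.

Section Diagram.
Variable D : link_diagram.
Implicit Types (c : crossing D) (a : arc D).

(* The four arcs at a crossing, both strands pointing upward. *)
Definition in_left c : arc D := inn (c, positive c).
Definition in_right c : arc D := inn (c, ~~ positive c).
Definition out_left c : arc D := out (c, ~~ positive c).
Definition out_right c : arc D := out (c, positive c).

(* [(a, true)] and [(a, false)] are the left and right side of [a]. *)
Definition side : finType := (arc D * bool)%type.

(* The corners of the complement at a crossing: west, east, south, north. *)
Definition corners c : seq (seq side) :=
  [:: [:: (in_left c, true); (out_left c, true)];
      [:: (in_right c, false); (out_right c, false)];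
      [:: (in_left c, false); (in_right c, true)];
      [:: (out_left c, false); (out_right c, true)]].

Definition same_corner : rel side := fun s1 s2 =>
  [exists c, has (fun k => (s1 \in k) && (s2 \in k)) (corners c)].

(* For a connected diagram, a region is the set of arc sides on its boundary. *)
Definition region : finType := {set side}.
Definition region_of (s : side) : region := [set s' | connect same_corner s s'].
Definition regions : {set region} := [set region_of s | s : side].

Definition arcs_meet : rel (arc D) := fun a1 a2 =>
  [exists c, let ends := [:: in_left c; in_right c; out_left c; out_right c] in
             (a1 \in ends) && (a2 \in ends)].

Definition connected_diagram : Prop :=
  forall a1 a2 : arc D, connect arcs_meet a1 a2.

(* Genus 0.  A connected diagram with C > 0 crossings has 2C arcs, so Euler's
   formula C - 2C + #regions = 2 characterizes the sphere; the round circle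
   (C = 0) has two regions as well. *)
Definition planar_diagram : Prop := #|regions| = (#|crossing D| + 2)%N.

Definition alternating : Prop :=
  forall c c' b b', out (c, b) = inn (c', b') -> b' = ~~ b.

Definition special : Prop := alternating /\ forall c, positive c.

(** ** The Seifert form

  Let F be the surface of Seifert's algorithm, placed so that each Seifert
  circle is the top edge of a vertical wall hanging below the plane of the
  diagram, the walls being capped by disjoint disks at various depths and
  joined, at each crossing, by a half-twisted band from the left strand to
  the right strand.  A 1-cycle on F minus the disks runs along the walls and
  the bands; recording its coefficient on the wall under each arc identifies
  such cycles with the 1-cycles [z] of the underlying 4-valent graph, and
  [band_flow z c] is its coefficient on the band at [c].  The multiples of the
  Seifert circles, which bound disks in F, are the cycles without band flow,
  so H_1(F) is the group of cycles modulo those with zero band flow.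

  The positive normal of F (for the orientation inducing that of the link)
  points to the left of the arcs, along every wall.  Hence the push-off b^+
  is b moved to the left, and in projection it passes over the cycle a only
  where the band of b leaves the left wall: it crosses the outgoing left arc
  if the crossing is positive and the incoming left arc if it is negative,
  each time from left to right, i.e. with sign +1.  Summing gives
  lk(a, b^+). *)
Definition is_cycle (z : arc D -> int) : Prop :=
  forall c, z (in_left c) + z (in_right c) = z (out_left c) + z (out_right c).

Definition band_flow (z : arc D -> int) c : int := z (in_left c) - z (out_left c).

Definition seifert_form (a b : arc D -> int) : int :=
  \sum_(c : crossing D)
     band_flow b c * a (if positive c then out_left c else in_left c).

Definition is_H1_basis m (b : 'I_m -> arc D -> int) : Prop :=
  (forall i, is_cycle (b i)) /\
  (forall z, is_cycle z ->
     exists! k : 'rV[int]_m,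
       forall c, band_flow z c = \sum_(i < m) k 0 i * band_flow (b i) c).

Definition seifert_matrix_of_diagram m (V : 'M[int]_m) : Prop :=
  exists2 b : 'I_m -> arc D -> int,
    is_H1_basis b & V = \matrix_(i, j) seifert_form (b i) (b j).

End Diagram.

(** * Seifert matrices, Alexander polynomial and signature *)

(* S-equivalence: unimodular congruence and the two elementary enlargements,
   realized by adding a tube to a Seifert surface. *)
Inductive S_equivalent : forall m n, 'M[int]_m -> 'M[int]_n -> Prop :=
| S_refl m (V : 'M[int]_m) : S_equivalent V V
| S_sym m n (V : 'M[int]_m) (W : 'M[int]_n) :
    S_equivalent V W -> S_equivalent W V
| S_trans m n p (U : 'M[int]_m) (V : 'M[int]_n) (W : 'M[int]_p) :
    S_equivalent U V -> S_equivalent V W -> S_equivalent U W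
| S_congr m (P V : 'M[int]_m) :
    P \in unitmx -> S_equivalent V (P^T *m V *m P)
| S_enlarge_row m (V : 'M[int]_m) (xi : 'cV[int]_m) :
    S_equivalent V
      (block_mx V (row_mx xi 0) 0 (delta_mx 0 1 : 'M[int]_(1 + 1)))
| S_enlarge_col m (V : 'M[int]_m) (eta : 'rV[int]_m) :
    S_equivalent V
      (block_mx V 0 (col_mx eta 0) (delta_mx 1 0 : 'M[int]_(1 + 1))).

(* Any two Seifert matrices of a link are S-equivalent, so this predicate
   holds of the Seifert matrices of all Seifert surfaces of the link. *)
Definition seifert_matrix (D : link_diagram) m (V : 'M[int]_m) : Prop :=
  exists m0 (V0 : 'M[int]_m0), seifert_matrix_of_diagram D V0 /\ S_equivalent V0 V.

(* Z[t^(1/2), t^(-1/2)] is viewed inside the field of rational functions in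
   the indeterminate [sqrt_t] = t^(1/2). *)
Definition rat_fun1 : fieldType := {fraction {poly int}}.
Definition sqrt_t : rat_fun1 := tofrac ('X : {poly int}).

Definition alexander_det m (V : 'M[int]_m) : rat_fun1 :=
  let Vt := map_mx (fun k : int => k%:~R : rat_fun1) V in
  \det (sqrt_t *: Vt - sqrt_t^-1 *: Vt^T).

(* The Alexander polynomial is defined up to sign, hence a relation. *)
Definition alexander_polynomial (D : link_diagram) (delta : rat_fun1) : Prop :=
  exists m (V : 'M[int]_m), seifert_matrix D V /\
    (delta = alexander_det V \/ delta = - alexander_det V).

(* Number of positive minus number of negative eigenvalues. *)
Definition signature m (A : 'M[int]_m) : int :=
  let ev := spectral_diag (map_mx (fun k : int => k%:~R : algC) A) in
  #|[set i | 0 < ev 0 i]|%:Z - #|[set i | ev 0 i < 0]|%:Z.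

Definition link_signature (D : link_diagram) (sigma : int) : Prop :=
  exists m (V : 'M[int]_m), seifert_matrix D V /\ sigma = signature (V + V^T).

(** * The Tait digraph *)

(* [u] and [v] are joined by a path in the graph with edge set [A], the edge
   [e] having endpoints [f e] and [g e]. *)
Definition joined (E V : finType) (f g : E -> V) (A : {set E}) : rel V :=
  connect (fun u v => [exists e in A, ((f e, g e) == (u, v)) ||
                                      ((f e, g e) == (v, u))]).

Section Tait.
Variable D : link_diagram.

(* Tail, head and adjacent faces of the edge through [c].  When the overstrand
   runs from lower left to upper right these are the bottom, top, left and
   right corners at [c].  The faces of the Tait digraph are named by the
   unshaded regions of D, each face containing exactly one of them. *)
Definition tail (c : crossing D) : region D := region_of (inn (c, true), false).
Definition head (c : crossing D) : region D := region_of (out (c, true), true).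
Definition left_face (c : crossing D) : region D := region_of (inn (c, true), true).
Definition right_face (c : crossing D) : region D := region_of (out (c, true), false).

(* [Sh] is the set of shaded regions, i.e. the vertex set of the digraph. *)
Definition tait_shading (Sh : {set region D}) : Prop :=
  [/\ Sh \subset regions D,
      forall a : arc D,
        (region_of (a, true) \in Sh) = (region_of (a, false) \notin Sh)
    & forall c : crossing D, tail c \in Sh /\ head c \in Sh].

Definition adjacent_face (r q : region D) : Prop :=
  exists (a : arc D) (b : bool), r = region_of (a, b) /\ q = region_of (a, ~~ b).

Variables (Sh : {set region D}) (r q : region D).
Implicit Type T : {set crossing D}.

Definition spanning_tree T : bool :=
  [forall u in Sh, forall v in Sh, joined tail head T u v] &&
  [forall e in T, ~~ joined tail head (T :\ e) (tail e) (head e)].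

Definition int_active T (e : crossing D) : bool :=
  joined tail head (T :\ e) r (tail e).

(* The edges of T + e lying on a cycle, i.e. those that are not bridges. *)
Definition tree_cycle T (e : crossing D) : {set crossing D} :=
  [set f in e |: T | joined tail head ((e |: T) :\ f) (tail f) (head f)].

(* [q] lies on the left of [e] with respect to the cycle: two faces are on the
   same side of a cycle when one can be reached from the other by passing
   through edges outside the cycle. *)
Definition ext_active T (e : crossing D) : bool :=
  joined left_face right_face (~: tree_cycle T e) q (left_face e).

Definition iota_pos T := #|[set e in T | positive e && int_active T e]|.
Definition iotabar_pos T := #|[set e in T | positive e && ~~ int_active T e]|.
Definition eps_neg T := #|[set e in ~: T | ~~ positive e && ext_active T e]|.
Definition epsbar_neg T := #|[set e in ~: T | ~~ positive e && ~~ ext_active T e]|.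

Definition tait_poly (R : comUnitRingType) (x y z w : R) : R :=
  \sum_(T : {set crossing D} | spanning_tree T)
     x ^- iota_pos T * y ^- iotabar_pos T * z ^+ eps_neg T * w ^+ epsbar_neg T.

End Tait.

(* Laurent polynomials in x^(1/2), y^(1/2), z, w, inside the field of rational
   functions in these four indeterminates. *)
Definition rat_fun4 : fieldType := {fraction {mpoly int[4]}}.
Definition indet4 (i : 'I_4) : rat_fun4 := tofrac ('X_i : {mpoly int[4]}).
Definition sqrt_x : rat_fun4 := indet4 (inord 0).
Definition sqrt_y : rat_fun4 := indet4 (inord 1).
Definition var_z : rat_fun4 := indet4 (inord 2).
Definition var_w : rat_fun4 := indet4 (inord 3).

(* Main.v *)
Require Import Defs.
From HB Require Import structures.
From mathcomp.multinomials Require Import mpoly.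
From mathcomp Require Import all_boot all_order all_fingroup all_algebra all_field.
From mathcomp Require Import ring.
Import Defs.

Set Implicit Arguments.
Unset Strict Implicit.
Unset Printing Implicit Defensive.

Import Order.TTheory GRing.Theory Num.Theory.
Local Open Scope ring_scope.

(** The faces of the Tait digraph of a special alternating diagram are bounded
  by the Seifert circles, so the cycles around the non-root vertices form a
  basis of the first homology of the Seifert surface; in this basis the Seifert
  matrix is minus the Laplacian L of the digraph, reduced at the root.  The
  digraph is Eulerian, so the matrix-tree theorem computes det(xL + yL^T) as the
  sum over the spanning trees of x^iota y^iotabar.  For x = -t^(1/2) and
  y = t^(-1/2) this is the Alexander polynomial, in which trees contributing to
  the same power of t have the same sign.  The form L + L^T is positive definite,
  so the signature is minus the number of non-root vertices.  The exchange of x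
  and y needed at the end is transposition.  Since the hypotheses only provide
  Seifert matrices up to S-equivalence, the determinant and (by Sylvester's law
  of inertia) the signature are shown to be invariant under it. *)

(** * Invariance under S-equivalence *)

(** The left factor has a single nonzero column and the right factor a single nonzero row; they meet
    only the upper left entry of the middle matrix, whose diagonal is zero. *)
Lemma mul_row_hyperbolic (R : pzRingType) m k (b : 'cV[R]_m) (c : 'rV[R]_k) (s t : R) :
  row_mx b (0 : 'cV_m) *m (s *: delta_mx 0 1 + t *: delta_mx 1 0 : 'M_(1 + 1)) *m
    col_mx c (0 : 'rV_k) = 0.
Proof.
apply/matrixP => i j; rewrite -mulmxA !mxE big_split_ord /= !big_ord1.
rewrite !(row_mxEl, row_mxEr) !mxE big_split_ord /= !big_ord1.
rewrite !(col_mxEu, col_mxEd) !mxE /=.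
by rewrite !(mulr0, mul0r, addr0).
Qed.

(** Schur complement: [J] has determinant 1, and eliminating the upper right block would correct [A]
    by a term through the inverse [J'] of [J]. As [J'] has zero diagonal, this correction
    vanishes. *)
Lemma det_block_hyperbolic (R : comUnitRingType) m (A : 'M[R]_m)
    (b : 'cV_m) (c : 'rV_m) (s : R) : s \is a GRing.unit ->
  \det (block_mx A (row_mx b 0) (col_mx c 0)
          (s *: delta_mx 0 1 - s^-1 *: delta_mx 1 0 : 'M_(1 + 1))) = \det A.
Proof.
move=> us; set J := (X in block_mx A _ _ X).
pose J' : 'M[R]_(1 + 1) := - s *: delta_mx 0 1 + s^-1 *: delta_mx 1 0.
have JJ' : J' *m J = 1%:M.
  apply/matrixP => i j; rewrite !mxE big_split_ord /= !big_ord1 !mxE.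
  by case: (@split_ordP 1 1 i) => k ->; case: (@split_ordP 1 1 j) => l ->;
    rewrite !ord1 /= ?(mulr0, mulr1, mul0r, addr0, add0r, subr0, sub0r,
      mulrN, mulNr, opprK, mulrV, mulVr, oppr0).
have detJ : \det J = 1.
  rewrite (expand_det_row _ 0) !big_ord_recl big_ord0 /cofactor !mxE /= !det_mx11 !mxE /=.
  by rewrite !(mulr0, mulr1, subr0, sub0r, oppr0, add0r, addr0) expr1 mulrN mulN1r opprK mulrV.
have -> : block_mx A (row_mx b 0) (col_mx c 0) J =
    block_mx 1%:M (row_mx b 0 *m J') 0 1%:M *m block_mx A 0 (col_mx c 0) J.
  rewrite mulmx_block !mul1mx !mul0mx !add0r mul_row_hyperbolic addr0.
  by rewrite -mulmxA JJ' mulmx1.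
by rewrite det_mulmx det_ublock det_lblock !det1 detJ !mul1r mulr1.
Qed.

Lemma sqrt_t_unit : sqrt_t \is a GRing.unit.
Proof. by rewrite unitfE tofrac_eq0 polyX_eq0. Qed.

Lemma alexander_detE m (V : 'M[int]_m) :
  alexander_det V = \det (sqrt_t *: map_mx intr V - sqrt_t^-1 *: (map_mx intr V)^T).
Proof. by []. Qed.

(** A unimodular congruence multiplies the determinant by the square of [\det P], which is 1; both
    enlargements have the shape treated in [det_block_hyperbolic]. *)
Lemma alexander_det_S_equivalent m n (V : 'M[int]_m) (W : 'M[int]_n) :
  S_equivalent V W -> alexander_det V = alexander_det W.
Proof.
elim=> {m n V W} [//|m n V W _ -> //|m n p U V W _ -> _ -> //|m P V uP|m V xi|m V eta];
  rewrite !alexander_detE.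
- pose Q : 'M[rat_fun1]_m := map_mx intr P; pose A : 'M[rat_fun1]_m := map_mx intr V.
  have -> : map_mx intr (P^T *m V *m P) = Q^T *m A *m Q by rewrite !map_mxM map_trmx.
  have -> : sqrt_t *: (Q^T *m A *m Q) - sqrt_t^-1 *: (Q^T *m A *m Q)^T =
            Q^T *m (sqrt_t *: A - sqrt_t^-1 *: A^T) *m Q.
    by rewrite !trmx_mul trmxK mulmxBr mulmxBl -!scalemxAr -!scalemxAl mulmxA.
  rewrite !det_mulmx det_tr.
  rewrite mulrAC det_map_mx -rmorphM /=; suff -> : \det P * \det P = 1 by rewrite mul1r.
  by move: uP; rewrite unitmxE => /orP[] /eqP ->.
- rewrite -[LHS](det_block_hyperbolic _ (sqrt_t *: map_mx intr xi)
    (- sqrt_t^-1 *: (map_mx intr xi)^T) sqrt_t_unit); congr (\det _).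
  rewrite !map_block_mx !map_row_mx !raddf0 tr_block_mx tr_row_mx !trmx0.
  rewrite !map_delta_mx trmx_delta !scale_block_mx opp_block_mx add_block_mx.
  rewrite !scale_row_mx !scale_col_mx !scaler0 opp_col_mx !oppr0 addr0 add0r.
  by rewrite scaleNr.
(* In a column enlargement the entry of the new block above the diagonal is [- sqrt_t^-1], which
   therefore plays the role of [s]. *)
- have us : - sqrt_t^-1 \is a GRing.unit by rewrite unitrN unitrV sqrt_t_unit.
  rewrite -[LHS](det_block_hyperbolic _ (- sqrt_t^-1 *: (map_mx intr eta)^T)
    (sqrt_t *: map_mx intr eta) us); congr (\det _).
  rewrite !map_block_mx !map_col_mx !raddf0 tr_block_mx tr_col_mx !trmx0.
  rewrite !map_delta_mx trmx_delta !scale_block_mx opp_block_mx add_block_mx.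
  rewrite !scale_row_mx !scale_col_mx !scaler0 opp_row_mx !oppr0 addr0 add0r.
  by rewrite invrN invrK !scaleNr opprK [X in block_mx _ _ _ X = _]addrC.
Qed.

(** * Sylvester's law of inertia and the signature *)

Section Inertia.
Local Open Scope sesquilinear_scope.

Lemma hermitian_diag n (u : 'rV[algC]_n) (d : 'rV_n) :
  (u *m diag_mx d *m u^t*) 0 0 = \sum_i d 0 i * `|u 0 i| ^+ 2.
Proof.
rewrite mxE; apply: eq_bigr => i _; rewrite mul_mx_diag !mxE.
by rewrite normCK mulrCA mulrA.
Qed.

(** If [e] had more positive entries than [d], a dimension count would give a nonzero [u] supported
    on the positive entries of [e] whose image [w] vanishes on those of [d]. The form would then be
    positive at [u] when computed with [e], but at most 0 when computed with [d]. *)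
Lemma inertia_le n (P : 'M[algC]_n) (d e : 'rV_n) :
  d \is a realmx -> diag_mx e = P^t* *m diag_mx d *m P ->
  (#|[set i | (0 < e 0%R i)%R]| <= #|[set i | (0 < d 0%R i)%R]|)%N.
Proof.
move=> dR eP; rewrite leqNgt; apply/negP => lt.
set p := #|_| in lt; set q := #|_| in lt.
pose M : 'M[algC]_(q, p) := \matrix_(i, j) (P^t* (enum_val i) (enum_val j)).
have /rowV0Pn[v /sub_kermxP vM v0] : kermx M != 0.
  rewrite kermx_eq0 /row_free; apply: contraL lt => /eqP <-.
  by rewrite -leqNgt rank_leq_col.
pose u : 'rV[algC]_n := v *m (\matrix_(i, k) (enum_val i == k)%:R).
have uE i : u 0 (enum_val i) = v 0 i.
  rewrite mxE (bigD1 i) //= mxE eqxx mulr1 big1 ?addr0 // => j ji.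
  by rewrite mxE (inj_eq enum_val_inj) (negPf ji) mulr0.
have u0 k : ~~ (0 < e 0 k) -> u 0 k = 0.
  move=> ek; rewrite mxE big1 // => i _; rewrite mxE.
  case: eqP => [ki|_]; rewrite ?mulr0 //.
  by move: (enum_valP i) ek; rewrite ki inE => ->.
pose w := u *m P^t*.
have w0 k : 0 < d 0 k -> w 0 k = 0.
  move=> dk; have kD : k \in [set i | 0 < d 0 i] by rewrite inE.
  transitivity ((v *m M) 0 (enum_rank_in kD k)); last by rewrite vM mxE.
  rewrite /w /u -mulmxA !mxE; apply: eq_bigr => i _; congr (_ * _).
  rewrite !mxE (bigD1 (enum_val i)) //= !mxE eqxx mul1r big1 ?addr0.
    by rewrite enum_rankK_in.
  by move=> l; rewrite eq_sym => /negPf ne; rewrite mxE ne mul0r.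
have eqf : \sum_i e 0 i * `|u 0 i| ^+ 2 = \sum_i d 0 i * `|w 0 i| ^+ 2.
  have wC : w^t* = P *m u^t* by rewrite trmx_mul map_mxM /= trmxCK.
  by rewrite -!hermitian_diag eP wC !mulmxA.
case/rV0Pn: v0 => i vi; move: eqf; apply/eqP; rewrite gt_eqF //.
apply: (@le_lt_trans _ _ 0).
  apply: sumr_le0 => k _; have dk := mxOverP dR 0 k.
  have [/w0 ->|dk0] := boolP (0 < d 0 k); first by rewrite normr0 expr0n mulr0.
  by rewrite mulr_le0_ge0 ?exprn_ge0 // real_leNgt.
rewrite (bigD1 (enum_val i)) //= ltr_pwDl //.
  rewrite mulr_gt0 ?exprn_gt0 ?normr_gt0 ?uE //.
  by have := enum_valP i; rewrite inE.
apply: sumr_ge0 => k _; have [/ltW ek|/u0 ->] := boolP (0 < e 0 k).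
  by rewrite mulr_ge0 ?exprn_ge0.
by rewrite normr0 expr0n mulr0.
Qed.
Lemma inertia_eq n (P : 'M[algC]_n) (d e : 'rV_n) :
  P \in unitmx -> d \is a realmx -> e \is a realmx ->
  diag_mx e = P^t* *m diag_mx d *m P ->
  #|[set i | (0 < e 0%R i)%R]| = #|[set i | (0 < d 0%R i)%R]|.
Proof.
move=> uP dR eR eP; apply/eqP; rewrite eqn_leq (inertia_le dR eP) /=.
apply: (@inertia_le _ (invmx P)) => //.
have uPt : P^t* \in unitmx by rewrite map_unitmx unitmx_tr.
rewrite eP -!mulmxA mulmxV // mulmx1 mulmxA.
suff -> : (invmx P)^t* *m P^t* = 1%:M by rewrite mul1mx.
by rewrite -map_mxM -trmx_mul mulmxV // trmx1 map_mx1.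
Qed.

Lemma mxOver_real_opp n (d : 'rV[algC]_n) : d \is a realmx -> - d \is a realmx.
Proof. by move/mxOverP => dR; apply/mxOverP => i j; rewrite mxE realN. Qed.

(** This allows the signature to be read off any diagonalization by congruence, not only the
    spectral one. Negative entries are counted as the positive entries of the opposite diagonal. *)
Lemma signature_diag n (A : 'M[int]_n) (P : 'M[algC]_n) (d : 'rV_n) :
  P \in unitmx -> d \is a realmx -> map_mx intr A = P^t* *m diag_mx d *m P ->
  signature A = #|[set i | (0 < d 0%R i)%R]|%:Z - #|[set i | (d 0%R i < 0)%R]|%:Z.
Proof.
move=> uP dR; rewrite /signature; set B := map_mx _ _ => BE.
have {}BE : B = P^t* *m diag_mx d *m P by [].
set ev := spectral_diag B; pose U := spectralmx B.
have Bherm : B \is hermsymmx.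
  apply/is_hermitianmxP; rewrite expr0 scale1r BE !trmx_mul !map_mxM /= trmxCK.
  by rewrite tr_diag_mx map_diag_mx (realmxC dR) mulmxA.
have evR : ev \is a realmx by apply: hermitian_spectral_diag_real.
have uU : U \in unitmx := spectral_unit B.
have UC : invmx U = U^t* by rewrite invmx_unitary ?spectral_unitarymx.
have /hermitian_normalmx/orthomx_spectralP BU := Bherm.
pose Q := P *m invmx U.
have uQ : Q \in unitmx by rewrite unitmx_mul uP unitmx_inv.
have QC : Q^t* = U *m P^t* by rewrite trmx_mul map_mxM /= UC trmxCK.
have evE : diag_mx ev = Q^t* *m diag_mx d *m Q.
  have : U *m B *m invmx U = diag_mx ev.
    by rewrite {1}BU !mulmxA mulmxV // mul1mx mulmxK.
  by rewrite BE QC => <-; rewrite !mulmxA.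
have neg (x : 'rV[algC]_n) : [set i | (x 0 i < 0)%R] = [set i | (0 < (- x) 0%R i)%R].
  by apply/setP => i; rewrite !inE mxE oppr_gt0.
rewrite (inertia_eq uQ dR evR evE) !neg; congr (_ - _%:Z).
apply: (inertia_eq uQ); rewrite ?mxOver_real_opp //.
by rewrite [diag_mx (- d)]raddfN [diag_mx (- ev)]raddfN /= mulmxN mulNmx evE.
Qed.

Lemma symmetric_int_diag n (A : 'M[int]_n) : A^T = A ->
  exists P : 'M[algC]_n, exists d : 'rV[algC]_n,
    [/\ P \in unitmx, d \is a realmx & map_mx intr A = P^t* *m diag_mx d *m P].
Proof.
move=> sA; set B := map_mx _ _.
have Bherm : B \is hermsymmx.
  apply/is_hermitianmxP; rewrite expr0 scale1r; apply/matrixP => i j.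
  by rewrite !mxE -{1}sA mxE rmorph_int.
exists (spectralmx B), (spectral_diag B); split.
- exact: spectral_unit.
- exact: hermitian_spectral_diag_real.
have /hermitian_normalmx/orthomx_spectralP := Bherm.
by rewrite invmx_unitary ?spectral_unitarymx.
Qed.

Lemma signature_congr n (P A : 'M[int]_n) :
  P \in unitmx -> A^T = A -> signature (P^T *m A *m P) = signature A.
Proof.
move=> uP /symmetric_int_diag[Q [d [uQ dR AE]]].
rewrite (signature_diag uQ dR AE).
apply: (@signature_diag _ _ (Q *m map_mx intr P)) => //.
  rewrite unitmx_mul uQ unitmxE det_map_mx /=.
  by move: uP; rewrite unitmxE => /orP[] /eqP ->; rewrite ?unitrN unitr1.
rewrite !map_mxM AE trmx_mul map_mxM /= !mulmxA; congr (_ *m _ *m _ *m _ *m _).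
by apply/matrixP => i j; rewrite !mxE rmorph_int.
Qed.

Definition hyperbolic : 'M[int]_(1 + 1) := delta_mx 0 1 + delta_mx 1 0.

Lemma hyperbolic_square : hyperbolic *m hyperbolic = 1%:M.
Proof.
apply/matrixP => i j; rewrite !mxE !big_ord_recl big_ord0 !mxE.
by case: i => [[|[|//]] ?]; case: j => [[|[|//]] ?].
Qed.

Lemma signature_hyperbolic n (A : 'M[int]_n) : A^T = A ->
  signature (block_mx A 0 0 hyperbolic) = signature A.
Proof.
move=> /symmetric_int_diag[P [d [uP dR AE]]].
rewrite (signature_diag uP dR AE).
(* The rows of [Q] are (1, 1) and (1, -1): the hyperbolic form 2uv is half the difference of the
   squares of u + v and u - v. *)
pose Q : 'M[algC]_(1 + 1) := \matrix_(i, j) (-1) ^+ (i * j).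
pose e : 'rV[algC]_(1 + 1) := \row_i ((-1) ^+ i / 2%:R).
have half : 2%:R^-1 + 2%:R^-1 = 1 :> algC by rewrite [RHS]splitr mul1r.
have QE : map_mx intr hyperbolic = Q^t* *m diag_mx e *m Q.
  apply/matrixP => i j; rewrite [RHS]mxE !big_ord_recl big_ord0 !mul_mx_diag !mxE.
  by case: i => [[|[|//]] ?]; case: j => [[|[|//]] ?];
    rewrite !rmorphXn !rmorphN1 /= /bump /= ?(mul0n, muln0, muln1) ?expr0 ?expr1
      ?(mulN1r, mulrN1, mulNr, opprK) !(mul1r, mulr1, addr0) ?subrr ?opprK ?half.
have HH := hyperbolic_square.
have uQ : Q \in unitmx.
  have : Q^t* *m diag_mx e *m (Q *m map_mx intr hyperbolic) = 1%:M.
    by rewrite mulmxA -QE -map_mxM HH map_mx1.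
  by case/mulmx1_unit => _; rewrite unitmx_mul => /andP[].
have e0 : e 0 (lshift 1 ord0) = 2%:R^-1 by rewrite mxE expr0 mul1r.
have e1 : e 0 (rshift 1 ord0) = - 2%:R^-1 by rewrite mxE expr1 mulN1r.
have count (p : pred algC) : #|[set i | p (row_mx d e 0%R i)]| =
    (#|[set i | p (d 0%R i)]| + (p (2%:R^-1)%R + p (- 2%:R^-1)%R))%N.
  rewrite -!sum1_card big_mkcond !big_split_ord /= !big_ord1 !inE !row_mxEr e0 e1.
  congr (_ + (_ + _))%N; try by case: (p _).
  by rewrite [RHS]big_mkcond; apply: eq_bigr => i _; rewrite !inE row_mxEl.
rewrite (@signature_diag _ _ (block_mx P 0 0 Q) (row_mx d e)).
- rewrite (count (fun x => 0 < x)) (count (fun x => x < 0)).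
  rewrite oppr_gt0 oppr_lt0 !invr_gt0 !invr_lt0 !ltr0n !ltrn0 /= addn0 add0n.
  by rewrite !PoszD opprD addrACA subrr addr0.
- by rewrite unitmxE det_ublock unitrM -!unitmxE uP.
- apply/mxOverP => i j; rewrite mxE; case: split => k; first exact: (mxOverP dR).
  by rewrite mxE rpred_div ?rpredX ?rpredN ?rpred1 ?realn.
- rewrite diag_mx_row tr_block_mx !map_block_mx QE AE !mulmx_block.
  by rewrite !trmx0 !map_mx0 !(mul0mx, mulmx0, addr0, add0r).
Qed.

(** Congruence by the unipotent [P] produces the border from the block diagonal form; the change it
    makes to [A] vanishes by [mul_row_hyperbolic]. *)
Lemma signature_block_hyperbolic n (A : 'M[int]_n) (b : 'cV_n) : A^T = A ->
  signature (block_mx A (row_mx b 0) (col_mx b^T 0) hyperbolic) = signature A.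
Proof.
move=> sA; rewrite -[RHS](signature_hyperbolic sA).
have HT : hyperbolic^T = hyperbolic by rewrite linearD /= !trmx_delta addrC.
have HH := hyperbolic_square.
have BHB : row_mx b 0 *m hyperbolic *m col_mx b^T 0 = 0.
  have := mul_row_hyperbolic b b^T 1 1; rewrite !scale1r; exact.
pose P : 'M[int]_(n + (1 + 1)) := block_mx 1%:M 0 (hyperbolic *m col_mx b^T 0) 1%:M.
have uP : P \in unitmx by rewrite unitmxE det_lblock !det1 mulr1 unitr1.
have sM : (block_mx A 0 0 hyperbolic)^T = block_mx A 0 0 hyperbolic.
  by rewrite tr_block_mx sA HT !trmx0.
rewrite -(signature_congr uP sM); congr signature.
rewrite /P tr_block_mx !trmx1 trmx0 trmx_mul HT tr_col_mx trmxK trmx0.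
rewrite !mulmx_block !(mul1mx, mulmx1, mul0mx, mulmx0, addr0, add0r).
have HHr k (X : 'M_(k, 1 + 1)) : X *m hyperbolic *m hyperbolic = X.
  by rewrite -mulmxA HH mulmx1.
by rewrite !mulmxA !HHr BHB addr0 HH mul1mx.
Qed.

Lemma signature_S_equivalent m n (V : 'M[int]_m) (W : 'M[int]_n) :
  S_equivalent V W -> signature (V + V^T) = signature (W + W^T).
Proof.
elim=> {m n V W} [//|m n V W _ -> //|m n p U V W _ -> _ -> //|m P V uP|m V xi|m V eta].
- have symV : (V + V^T)^T = V + V^T by rewrite linearD /= trmxK addrC.
  rewrite -[LHS](signature_congr uP symV); congr signature.
  by rewrite !trmx_mul trmxK mulmxDr mulmxDl !mulmxA.
- have symV : (V + V^T)^T = V + V^T by rewrite linearD /= trmxK addrC.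
  rewrite -[LHS](signature_block_hyperbolic xi symV); congr signature.
  by rewrite tr_block_mx tr_row_mx !trmx0 trmx_delta add_block_mx addr0 add0r.
have symV : (V + V^T)^T = V + V^T by rewrite linearD /= trmxK addrC.
rewrite -[LHS](signature_block_hyperbolic eta^T symV); congr signature.
rewrite tr_block_mx tr_col_mx !trmx0 trmx_delta add_block_mx addr0 add0r trmxK.
by rewrite [X in block_mx _ _ _ X = _]addrC.
Qed.

Lemma signature_negative_definite n (A : 'M[int]_n) : A^T = A ->
  (forall v : 'rV[algC]_n, v != 0 -> (v *m map_mx intr A *m v^t*) 0 0 < 0) ->
  signature A = - n%:Z.
Proof.
move=> /symmetric_int_diag[P [d [uP dR AE]]] neg; rewrite (signature_diag uP dR AE).
have d_neg i : d 0 i < 0.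
  have uPt : P^t* \in unitmx by rewrite map_unitmx unitmx_tr.
  (* The form is tested on the vector that becomes the [i]-th basis vector in the diagonalizing
     coordinates, where its value is [d 0 i]. *)
  pose w : 'rV[algC]_n := delta_mx 0 i; have [v vP] : exists v, v *m P^t* = w.
    by exists (w *m invmx (P^t*)); rewrite mulmxKV.
  have v0 : v != 0.
    apply/eqP => v0; move/rowP/(_ i): vP; rewrite v0 mul0mx !mxE !eqxx => /esym/eqP.
    by rewrite oner_eq0.
  have Pv : P *m v^t* = w^t* by rewrite -vP trmx_mul map_mxM /= trmxCK.
  have := neg v v0; rewrite AE !mulmxA vP -mulmxA Pv hermitian_diag (bigD1 i) //=.
  rewrite big1 => [|j ji]; first by rewrite mxE !eqxx normr1 expr1n mulr1 addr0.
  by rewrite mxE (negPf ji) andbF normr0 expr0n mulr0.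
have -> : [set i | (0 < d 0%R i)%R] = set0.
  by apply/setP => i; rewrite !inE lt_gtF.
have -> : [set i | (d 0%R i < 0)%R] = setT by apply/setP => i; rewrite !inE d_neg.
by rewrite cards0 cardsT card_ord sub0r.
Qed.
End Inertia.

(** * The matrix-tree theorem *)

(** The Cauchy-Binet expansion before terms are grouped by subsets. Functions are kept because a
    rooted tree will be encoded as a choice of one edge for each non-root vertex. *)
Lemma det_matrix_sum (R : comPzRingType) (E : finType) n
    (A : 'I_n -> E -> R) (B : E -> 'I_n -> R) :
  \det (\matrix_(i, j) \sum_e A i e * B e j) =
  \sum_(f : {ffun 'I_n -> E})
    (\prod_i A i (f i)) * \det (\matrix_(i, j) B (f i) j).
Proof.
pose AB (s : 'S_n) i e := A i e * B e (s i).
transitivity (\sum_(f : {ffun 'I_n -> E}) \sum_(s : 'S_n)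
                (-1) ^+ s * \prod_i AB s i (f i)).
  rewrite exchange_big; apply: eq_bigr => /= s _; rewrite -big_distrr /=.
  congr (_ * _); rewrite -(bigA_distr_bigA (AB s)) /=.
  by apply: eq_bigr => i _; rewrite mxE.
apply: eq_bigr => f _; rewrite big_distrr /=; apply: eq_bigr => s _.
rewrite mulrCA big_split //=; congr (_ * (_ * _)).
by apply: eq_bigr => i _; rewrite mxE.
Qed.

Lemma det_row_scale (R : comPzRingType) n (a : 'I_n -> R) (M : 'M[R]_n) :
  \det (\matrix_(i, j) (a i * M i j)) = (\prod_i a i) * \det M.
Proof.
have -> : \matrix_(i, j) (a i * M i j) = diag_mx (\row_i a i) *m M.
  by apply/matrixP => i j; rewrite mul_diag_mx !mxE.
rewrite det_mulmx det_diag; congr (_ * _).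
by apply: eq_bigr => i _; rewrite mxE.
Qed.

Lemma fconnect_step (T : finType) (p : T -> T) u w :
  fconnect p u w = (u == w) || fconnect p (p u) w.
Proof.
apply/idP/orP => [|[/eqP -> //|]]; last exact/connect_trans/fconnect1.
case/iter_findex; case: (findex p u w) => [/= ->|k]; first by left; exact: eqxx.
by rewrite iterSr => <-; right; apply: fconnect_iter.
Qed.

Lemma fconnect_fixed (T : finType) (p : T -> T) u w :
  p u = u -> fconnect p u w = (u == w).
Proof.
move=> pu; apply/idP/eqP => [/iter_findex <-|-> //].
by elim: (findex _ _ _) => //= k <-; rewrite pu.
Qed.

(** If [u] returned to itself, repeating the return often enough would exceed the number of steps
    from [u] to [r], after which the orbit stays at the fixed point [r]. *)
Lemma fconnect_acyclic (T : finType) (p : T -> T) u r :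
  p r = r -> u != r -> fconnect p u r -> fconnect p (p u) u = false.
Proof.
move=> pr u_r /iter_findex; set m := findex _ _ _ => ur.
apply: contraNF u_r => /iter_findex; set k := findex _ _ _.
rewrite -iterSr => uu.
have fix_r j : iter j p r = r by elim: j => //= j ->.
have back j : iter (j * k.+1)%N p u = u by elim: j => // j IH; rewrite mulSn iterD IH.
by rewrite -(back m) mulnC mulSn addnC iterD ur fix_r.
Qed.

Section Joined.
Variables (E V : finType) (tl hd : E -> V).
Implicit Types (A B : {set E}) (u v w : V).

Lemma joined_sym A u v : joined tl hd A u v = joined tl hd A v u.
Proof.
apply: sym_connect_sym => a b; apply: eq_existsb => e.
by rewrite orbC.
Qed.

Lemma joined_trans A u v w :
  joined tl hd A u v -> joined tl hd A v w -> joined tl hd A u w.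
Proof. exact: connect_trans. Qed.

Lemma joined_edge A e : e \in A -> joined tl hd A (tl e) (hd e).
Proof. by move=> eA; apply/connect1/existsP; exists e; rewrite eA eqxx. Qed.

Lemma joined_mono A B u v :
  A \subset B -> joined tl hd A u v -> joined tl hd B u v.
Proof.
move=> /subsetP AB; apply: connect_sub => a b /existsP[e /andP[eA ab]].
by apply: connect1; apply/existsP; exists e; rewrite AB.
Qed.

Lemma joined_invariant (C : Type) (P : V -> C) A u v :
  (forall e, e \in A -> P (tl e) = P (hd e)) ->
  joined tl hd A u v -> P u = P v.
Proof.
move=> HP /connectP[s]; elim: s u => [|w s IH] u /= => [_ -> //|].
case/andP => /existsP[e /andP[/HP eq_e /orP[] /eqP[<- <-]]] /IH{}IH /IH <-.
  exact: eq_e.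
by rewrite eq_e.
Qed.
End Joined.

Section MatrixTree.
Variables (E V : finType) (tl hd : E -> V) (S : {set V}) (r : V).
Variables (n : nat) (nu : 'I_n -> V).
Hypotheses (nu_inj : injective nu).
Hypothesis nuP : forall u, reflect (exists i, u = nu i) ((u \in S) && (u != r)).
Hypotheses (rS : r \in S) (tlS : forall e, tl e \in S) (hdS : forall e, hd e \in S).
Implicit Types (f : {ffun 'I_n -> E}) (T : {set E}).

Let tree T : bool :=
  [forall u in S, forall v in S, joined tl hd T u v] &&
  [forall e in T, ~~ joined tl hd (T :\ e) (tl e) (hd e)].

Let active T e := joined tl hd (T :\ e) r (tl e).

Definition other_end e u := if hd e == u then tl e else hd e.

Definition parent f u :=
  if [pick i | nu i == u] is Some i then other_end (f i) u else u.

(** The edge chosen at a vertex may point either way. The boolean inequality demands that exactly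
    one of its ends be [nu i], which excludes loops and makes [other_end] the genuine opposite
    end. *)
Definition arborescence f :=
  [forall i, (hd (f i) == nu i) != (tl (f i) == nu i)] &&
  [forall i, fconnect (parent f) (nu i) r].

Lemma nu_root i : nu i != r.
Proof. by have /andP[] : (nu i \in S) && (nu i != r) by apply/nuP; exists i. Qed.

Lemma nuS i : nu i \in S.
Proof. by have /andP[] : (nu i \in S) && (nu i != r) by apply/nuP; exists i. Qed.

Lemma parent_nu f i : parent f (nu i) = other_end (f i) (nu i).
Proof.
by rewrite /parent; case: pickP => [j /eqP/nu_inj -> //|/(_ i)]; rewrite eqxx.
Qed.

Lemma parent_root f : parent f r = r.
Proof.
by rewrite /parent; case: pickP => // i; rewrite (negPf (nu_root i)).
Qed.

Lemma parentS f u : u \in S -> parent f u \in S.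
Proof.
rewrite /parent => uS; case: pickP => // i _; rewrite /other_end.
by case: ifP.
Qed.

(* A non-identity permutation contributing to the Leibniz formula would move some
   vertex along a cycle of [parent f], which then never reaches the root. *)
Lemma det_parent_rooted (R : comPzRingType) f :
  [forall i, fconnect (parent f) (nu i) r] ->
  \det (\matrix_(i, j) ((nu i == nu j)%:R - (parent f (nu i) == nu j)%:R : R)) = 1.
Proof.
move/forallP=> rt.
have par_neq i : parent f (nu i) != nu i.
  apply/negP => /eqP fx; move: (rt i); rewrite fconnect_fixed //.
  by rewrite (negPf (nu_root i)).
rewrite /determinant (bigD1 1%g) //= [X in _ + X]big1 => [|s s1].
  rewrite odd_perm1 mul1r addr0 big1 // => i _.
  by rewrite mxE perm1 eqxx (negPf (par_neq i)) subr0.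
suff [i Hi] : exists i, (nu i != nu (s i)) && (parent f (nu i) != nu (s i)).
  rewrite (bigD1 i) //= mxE; case/andP: Hi => /negPf -> /negPf ->.
  by rewrite subr0 mul0r mulr0.
apply/existsP; move: s1; apply: contraR => /existsPn H.
apply/eqP/permP => i; rewrite perm1; apply/eqP; apply/negPn/negP => si.
have moved k : (s ((s ^+ k)%g i) != (s ^+ k)%g i).
  elim: k => [|k IH]; first by rewrite expg0 perm1.
  by rewrite expgSr permM (inj_eq perm_inj).
have orb k : iter k (parent f) (nu i) = nu ((s ^+ k)%g i).
  elim: k => [|k IH]; first by rewrite expg0 perm1.
  rewrite iterS IH; have := H ((s ^+ k)%g i).
  rewrite negb_and !negbK (inj_eq nu_inj) eq_sym (negPf (moved k)) /=.
  by move/eqP ->; rewrite expgSr permM.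
have /iter_findex := rt i; rewrite orb => /eqP.
by rewrite (negPf (nu_root _)).
Qed.

(* The indicator of the vertices that do not lead to the root is in the kernel. *)
Lemma det_parent_unrooted (R : idomainType) f :
  ~~ [forall i, fconnect (parent f) (nu i) r] ->
  \det (\matrix_(i, j) ((nu i == nu j)%:R - (parent f (nu i) == nu j)%:R : R)) = 0.
Proof.
move/forallPn=> [i0 Hi0]; set M := \matrix_(i, j) _.
pose x : 'cV[R]_n := \col_i (~~ fconnect (parent f) (nu i) r)%:R.
have Mx : M *m x = 0.
  apply/colP => i; rewrite !mxE.
  have mulM j : M i j * x j 0 = ((i == j)%:R - (parent f (nu i) == nu j)%:R) * x j 0.
    by rewrite [M i j]mxE (inj_eq nu_inj).
  rewrite (eq_bigr _ (fun j _ => mulM j)).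
  under eq_bigr => j _ do rewrite mulrBl.
  rewrite sumrB (bigD1 i) //= eqxx mul1r big1 ?addr0; last first.
    by move=> j /negPf; rewrite eq_sym => ->; rewrite mul0r.
  have par_i : fconnect (parent f) (nu i) r = fconnect (parent f) (parent f (nu i)) r.
    by rewrite [LHS]fconnect_step (negPf (nu_root i)).
  have [pr|pr] := eqVneq (parent f (nu i)) r.
    rewrite mxE par_i pr connect0 /= sub0r big1 ?oppr0 // => j _.
    by rewrite eq_sym (negPf (nu_root _)) mul0r.
  have /nuP[k pk] : (parent f (nu i) \in S) && (parent f (nu i) != r).
    by rewrite pr parentS ?nuS.
  rewrite (bigD1 k) //= pk eqxx mul1r big1 => [|j /negPf kj]; last first.
    by rewrite (inj_eq nu_inj) eq_sym kj mul0r.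
  by rewrite !mxE par_i pk addr0 subrr.
have : \det M *: x = 0 by rewrite -mul_scalar_mx -mul_adj_mx -mulmxA Mx mulmx0.
move/colP/(_ i0); rewrite !mxE Hi0 mulr1; exact.
Qed.

Lemma det_laplacian_arborescences (R : idomainType) (x y : R) :
  \det (\matrix_(i, j) \sum_e
     (x * (hd e == nu i)%:R - y * (tl e == nu i)%:R) *
     ((hd e == nu j)%:R - (tl e == nu j)%:R)) =
  \sum_(f | arborescence f) \prod_i (if hd (f i) == nu i then x else y).
Proof.
rewrite (det_matrix_sum (fun i e => x * (hd e == nu i)%:R - y * (tl e == nu i)%:R)
   (fun e j => (hd e == nu j)%:R - (tl e == nu j)%:R)).
rewrite [RHS]big_mkcond /=; apply: eq_bigr => f _; rewrite /arborescence.
case: forallP => [inc|ninc] /=; last first.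
  (* If [f i] is a loop at [nu i], its incidence row vanishes; if it misses [nu i], its weight
     does. *)
  have [i] : exists i, (hd (f i) == nu i) == (tl (f i) == nu i).
    apply/existsP; apply: contraT => /existsPn; exact.
  case: (hd (f i) =P nu i) => h /eqP t.
    suff -> : \det (\matrix_(i, j) ((hd (f i) == nu j)%:R - (tl (f i) == nu j)%:R : R)) = 0.
      by rewrite mulr0.
    rewrite (expand_det_row _ i) big1 // => j _.
    by rewrite mxE h; move/esym/eqP: t => ->; rewrite subrr mul0r.
  by rewrite (bigD1 i) //= -t (introF eqP h) mulr0n !mulr0 subrr !mul0r.
rewrite -det_row_scale.
(* When [nu i] is the tail of [f i], the incidence row is the opposite of the parent row, and this
   sign turns the weight [- y] into [y]. *)
transitivity (\det (\matrix_(i, j) ((if hd (f i) == nu i then x else y) *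
   (\matrix_(i, j) ((nu i == nu j)%:R - (parent f (nu i) == nu j)%:R : R)) i j))).
  congr (\det _); apply/matrixP => i j; rewrite !mxE parent_nu /other_end.
  move: (inc i); case: (hd (f i) =P nu i) => h; case: (tl (f i) =P nu i) => t // _.
    by rewrite h mulr1 mulr0 subr0.
  by rewrite t mulr0 mulr1 sub0r mulNr -mulrN opprB.
rewrite det_row_scale; case: ifP => [/det_parent_rooted ->|/negbT/det_parent_unrooted ->].
  by rewrite mulr1.
by rewrite mulr0.
Qed.

Definition edges_of f : {set E} := [set f i | i : 'I_n].

(** * The spanning tree of an arborescence and its activities *)

Section OneArborescence.
Variables (f : {ffun 'I_n -> E}) (arb : arborescence f).

Let descends i u := fconnect (parent f) u (nu i).

Lemma arborescence_ends i :
  (hd (f i) = nu i /\ tl (f i) = parent f (nu i)) \/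
  (tl (f i) = nu i /\ hd (f i) = parent f (nu i) /\ hd (f i) != nu i).
Proof.
have /andP[/forallP/(_ i) inc _] := arb.
rewrite parent_nu /other_end; move: inc.
case: (hd (f i) =P nu i) => h; case: (tl (f i) =P nu i) => t // _; [by left|right].
by split=> //; split=> //; apply/eqP.
Qed.

Lemma arborescence_rooted u : u \in S -> fconnect (parent f) u r.
Proof.
move=> uS; have [-> //|ur] := eqVneq u r.
have /nuP[i ->] : (u \in S) && (u != r) by rewrite uS.
by have /andP[_ /forallP] := arb; apply.
Qed.

Lemma descends_parent i : descends i (parent f (nu i)) = false.
Proof.
apply: fconnect_acyclic (nu_root i) (arborescence_rooted (nuS i)).
exact: parent_root.
Qed.

(** Among the chosen edges only [f i] leaves the subtree below [nu i]: for [j != i], the path from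
    [nu j] to [nu i] must start with the step to the parent of [nu j]. *)
Lemma descends_edge i j : j != i -> descends i (tl (f j)) = descends i (hd (f j)).
Proof.
move=> ji; have -> : descends i (tl (f j)) = descends i (nu j).
  have step : descends i (nu j) = descends i (parent f (nu j)).
    by rewrite /descends fconnect_step (inj_eq nu_inj) (negPf ji).
  by case: (arborescence_ends j) => [[_ ->]|[-> _]].
have step : descends i (nu j) = descends i (parent f (nu j)).
  by rewrite /descends fconnect_step (inj_eq nu_inj) (negPf ji).
by case: (arborescence_ends j) => [[-> _]|[_ [-> _]]].
Qed.

Lemma arborescence_end_set i :
  [set tl (f i); hd (f i)] = [set nu i; parent f (nu i)].
Proof. by case: (arborescence_ends i) => [[-> ->]|[-> [-> _]]] //; rewrite setUC. Qed.

(** Two vertices choosing the same edge would be each other's parents, a cycle that never reaches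
    the root. *)
Lemma arborescence_inj : injective f.
Proof.
move=> i j fij; apply/eqP; apply: contraT => ij.
have pi : parent f (nu i) = nu j.
  have : nu j \in [set tl (f i); hd (f i)] by rewrite fij arborescence_end_set set21.
  rewrite arborescence_end_set !inE => /orP[/eqP/nu_inj/esym/eqP|/eqP -> //].
  by rewrite (negPf ij).
have pj : parent f (nu j) = nu i.
  have : nu i \in [set tl (f j); hd (f j)] by rewrite -fij arborescence_end_set set21.
  rewrite arborescence_end_set !inE => /orP[/eqP/nu_inj/eqP|/eqP -> //].
  by rewrite (negPf ij).
by have := descends_parent i; rewrite /descends pi fconnect_step pj connect0 orbT.
Qed.

Lemma joined_parent (A : {set E}) i : f i \in A -> joined tl hd A (nu i) (parent f (nu i)).
Proof.
move=> fA; have := joined_edge tl hd fA.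
by case: (arborescence_ends i) => [[-> ->]|[-> [-> _]]] //; rewrite joined_sym.
Qed.

Lemma joined_descends i u v :
  joined tl hd (edges_of f :\ f i) u v -> descends i u = descends i v.
Proof.
apply: joined_invariant => e /setD1P[ne /imsetP[j _ def_e]].
by rewrite def_e in ne *; apply: descends_edge; apply: contraNneq ne => <-.
Qed.

(** Deleting [f i] cuts off exactly the subtree below [nu i]: being in it is invariant along the
    other edges, and a vertex outside it walks to the root along parents without using [f i]. *)
Lemma joined_root_edges_of i u :
  u \in S -> joined tl hd (edges_of f :\ f i) r u = ~~ descends i u.
Proof.
move=> uS; apply/idP/idP => [ru|].
  suff <- : descends i r = descends i u.
    rewrite /descends fconnect_fixed ?parent_root // eq_sym.
    exact: nu_root.
  exact: joined_descends ru.
rewrite joined_sym; have /iter_findex := arborescence_rooted uS.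
move: (findex (parent f) u r) => k; elim: k u uS => [|k IH] u uS.
  by move=> /= -> _; apply: connect0.
rewrite iterSr => ur; have [->|nur] := eqVneq u r; first by rewrite /joined connect0.
have /nuP[j def_u] : (u \in S) && (u != r) by rewrite uS.
rewrite def_u in uS ur *; rewrite /descends fconnect_step negb_or (inj_eq nu_inj).
case/andP => ji nd; apply: joined_trans (IH _ (parentS f uS) ur nd).
apply: joined_parent; rewrite !inE (inj_eq arborescence_inj) ji.
by apply: imset_f.
Qed.

Lemma edges_of_connected u v : u \in S -> v \in S -> joined tl hd (edges_of f) u v.
Proof.
have to_root w : w \in S -> joined tl hd (edges_of f) w r.
  move=> wS; have /iter_findex := arborescence_rooted wS.
  move: (findex (parent f) w r) => k; elim: k w wS => [|k IH] w wS.
    by move=> /= ->; apply: connect0.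
  rewrite iterSr => wr; have [->|nwr] := eqVneq w r; first by rewrite /joined connect0.
  have /nuP[j def_w] : (w \in S) && (w != r) by rewrite wS.
  rewrite def_w in wS wr *; apply: joined_trans (IH _ (parentS f wS) wr).
  by apply/joined_parent/imset_f.
move=> uS vS; apply: joined_trans (to_root u uS) _.
by rewrite joined_sym; apply: to_root.
Qed.

Lemma tree_edges_of : tree (edges_of f).
Proof.
apply/andP; split.
  by apply/forall_inP => u uS; apply/forall_inP => v vS; apply: edges_of_connected.
apply/forall_inP => _ /imsetP[i _ ->]; apply/negP => /joined_descends.
have di : descends i (nu i) by apply: connect0.
by case: (arborescence_ends i) => [[-> ->]|[-> [-> _]]]; rewrite di descends_parent.
Qed.

(** The tail of [f i] stays on the root's side of the cut exactly when it is the parent end, so the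
    weight [x] marks the edges pointing away from the root. *)
Lemma active_edges_of i : active (edges_of f) (f i) = (hd (f i) == nu i).
Proof.
rewrite /active joined_root_edges_of //.
case: (arborescence_ends i) => [[-> ->]|[-> [_ /negPf ->]]].
  by rewrite descends_parent eqxx.
by rewrite /descends connect0.
Qed.

Lemma weight_edges_of (R : comPzRingType) (x y : R) :
  \prod_i (if hd (f i) == nu i then x else y) =
  x ^+ #|[set e in edges_of f | active (edges_of f) e]| *
  y ^+ #|[set e in edges_of f | ~~ active (edges_of f) e]|.
Proof.
under eq_bigr => i _ do rewrite -active_edges_of.
rewrite -(big_imset (fun e => if active (edges_of f) e then x else y)) /=; last first.
  by move=> i j _ _; apply: arborescence_inj.
rewrite -/(edges_of f) (bigID (active (edges_of f))) /=; congr (_ * _).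
  rewrite -prodr_const; apply: eq_big => [e|e /andP[_ ->] //].
  by rewrite inE.
rewrite -prodr_const; apply: eq_big => [e|e /andP[_ /negPf ->] //].
by rewrite inE.
Qed.
End OneArborescence.

(** If [f i] were the edge [g j] with [j] different from [i], then [nu j] would be the parent of
    [nu i] for [f]. Deleting this common edge would leave [nu j] joined to the root according to
    [f], but cut off according to [g]. *)
Lemma edges_of_inj : {in arborescence &, injective edges_of}.
Proof.
move=> f g af ag fg; apply/ffunP => i.
have /imsetP[j _ fj] : f i \in edges_of g by rewrite -fg imset_f.
have [def_j|ij] := eqVneq i j; first by rewrite fj def_j.
have nij : nu i == nu j = false by rewrite (inj_eq nu_inj) (negPf ij).
have pf : parent f (nu i) = nu j.
  have : nu j \in [set tl (f i); hd (f i)] by rewrite fj (arborescence_end_set ag) set21.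
  by rewrite (arborescence_end_set af) !inE eq_sym nij => /eqP.
have := joined_root_edges_of af i (nuS j); rewrite -[in RHS]pf descends_parent //.
by rewrite fg fj (joined_root_edges_of ag) ?nuS // connect0.
Qed.

(** Each non-root vertex chooses the first edge of a shortest walk to the root inside [T]. *)
Lemma tree_arborescence T : tree T -> exists2 f, arborescence f & edges_of f = T.
Proof.
case/andP => /forall_inP conn /forall_inP acyc.
(* [within k u] says that [T] contains a walk of exactly [k] edges from [u] to [r]; the length is
   explicit so that it can be minimized. *)
pose fix within (k : nat) (u : V) {struct k} := if k is k'.+1 then
   [exists e in T, (hd e == u) && within k' (tl e) || (tl e == u) && within k' (hd e)]
   else u == r.
have ex_within u : u \in S -> exists k, within k u.
  move=> uS; have /forall_inP/(_ u uS) := conn r rS.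
  case/connectP => s; elim/last_ind: s u {uS} => [u _ -> /=|s v IH u].
    by exists 0; apply: eqxx.
  rewrite rcons_path last_rcons => /andP[/IH{}IH sv ->].
  have [k wk] := IH _ (erefl _); exists k.+1.
  case/existsP: sv => e /andP[eT /orP[]] /eqP[t h]; apply/existsP; exists e.
    by rewrite eT t h eqxx; apply/orP; left.
  by rewrite eT t h eqxx; apply/orP; right.
have step i : exists e, [/\ e \in T, (hd e == nu i) != (tl e == nu i) &
    forall k, within k (nu i) ->
      exists2 k', (k' < k)%N & within k' (other_end e (nu i))].
  case: (ex_minnP (ex_within _ (nuS i))) => -[|k]; first by rewrite /= (negPf (nu_root i)).
  move=> /existsP[e /andP[eT wk]] min_k; exists e.
  have min_lt w : within k w -> w != nu i.
    by move=> ww; apply: contraTneq ww => ->; apply/negP => /min_k; rewrite ltnn.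
  have other : within k (other_end e (nu i)).
    rewrite /other_end; case/orP: wk => /andP[/eqP-> wk]; first by rewrite eqxx.
    by rewrite (negPf (min_lt _ wk)).
  split=> //; last by move=> k' /min_k lt_k; exists k.
  case/orP: wk => /andP[-> /min_lt /negPf ->] //.
have [f Hf] := fin_all_exists step.
pose F := finfun f; have FE i : F i = f i by rewrite ffunE.
have arbF : arborescence F.
  apply/andP; split; first by apply/forallP => i; rewrite FE; case: (Hf i).
  apply/forallP => i; have [k] := ex_within _ (nuS i).
  elim/ltn_ind: k i => k IH i wk; rewrite fconnect_step parent_nu FE.
  have [_ _ /(_ k wk)[k' lt_k wk']] := Hf i.
  have [->|nr] := eqVneq (other_end (f i) (nu i)) r; first by rewrite connect0 orbT.
  have /nuP[j oj] : (other_end (f i) (nu i) \in S) && (other_end (f i) (nu i) != r).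
    by rewrite nr andbT /other_end; case: ifP.
  by rewrite oj (IH k') ?orbT // -oj.
have sFT : edges_of F \subset T.
  by apply/subsetP => _ /imsetP[i _ ->]; rewrite FE; case: (Hf i).
exists F => //; apply/eqP; rewrite eqEsubset sFT; apply/subsetP => e eT.
(* The edges of [F] already join all vertices, so a further edge of [T] would close a cycle. *)
apply: contraLR (acyc e eT) => eF; rewrite negbK.
apply: joined_mono (edges_of_connected arbF (tlS e) (hdS e)).
by rewrite subsetD1 sFT.
Qed.

(** This holds for any digraph on [S]. The balance of in- and out-degrees enters only later, when
    the matrix is rewritten through the Laplacian and its transpose. *)
Theorem matrix_tree (R : idomainType) (x y : R) :
  \det (\matrix_(i, j) \sum_e
     (x * (hd e == nu i)%:R - y * (tl e == nu i)%:R) *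
     ((hd e == nu j)%:R - (tl e == nu j)%:R)) =
  \sum_(T | tree T) x ^+ #|[set e in T | active T e]| *
                    y ^+ #|[set e in T | ~~ active T e]|.
Proof.
rewrite det_laplacian_arborescences.
rewrite (eq_bigr _ (fun f af => weight_edges_of af x y)).
rewrite -(big_imset (fun T => x ^+ #|[set e in T | active T e]| *
   y ^+ #|[set e in T | ~~ active T e]|) edges_of_inj) /=.
apply: eq_bigl => T; apply/imsetP/idP => [[f af ->]|/tree_arborescence[f af <-]].
  exact: tree_edges_of.
by exists f.
Qed.

Lemma card_tree T : tree T -> #|T| = n.
Proof.
case/tree_arborescence => f af <-.
by rewrite card_imset ?card_ord //; apply: arborescence_inj.
Qed.
End MatrixTree.

(** * Cycles and boundaries of planar diagrams *)

Lemma connect_invariant (T : finType) (C : Type) (e : rel T) (P : T -> C) x y :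
  (forall x y, e x y -> P x = P y) -> connect e x y -> P x = P y.
Proof.
move=> eP /connectP[s]; elim: s x => [x _ -> //|z s IH x /= /andP[/eP -> ]].
exact: IH.
Qed.

Lemma sum_delta_fun (R : pzRingType) (T : finType) (f : T -> R) a :
  \sum_t f t * (t == a)%:R = f a.
Proof.
rewrite (bigD1 a) //= eqxx mulr1 big1 ?addr0 // => t /negPf ->.
by rewrite mulr0.
Qed.

Lemma sum_enum_val (R : pzRingType) (T : finType) (F : T -> R) :
  \sum_(i < #|T|) F (enum_val i) = \sum_t F t.
Proof. by rewrite -big_enum_val. Qed.

Section Topology.
Variable D : link_diagram.
Implicit Types (c : crossing D) (a : arc D).

(** The cellular boundary of the 2-chain [phi]: with regions oriented counter-clockwise, an arc
    agrees with the boundary of the region on its left. *)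
Definition boundary (R : zmodType) (phi : region D -> R) a : R :=
  phi (region_of (a, true)) - phi (region_of (a, false)).

Lemma same_corner_sym : symmetric (@same_corner D).
Proof.
by move=> s t; apply: eq_existsb => c; apply: eq_has => k; rewrite andbC.
Qed.

Lemma region_of_corner c (k : seq (side D)) s t :
  k \in corners c -> s \in k -> t \in k -> region_of s = region_of t.
Proof.
move=> kc sk tk; apply/setP => u; rewrite !inE.
apply: same_connect; first exact: sym_connect_sym same_corner_sym.
by apply/connect1/existsP; exists c; apply/hasP; exists k; rewrite ?sk.
Qed.

Lemma region_west c : region_of (in_left c, true) = region_of (out_left c, true).
Proof.
by apply: (@region_of_corner c [:: (in_left c, true); (out_left c, true)]);
  rewrite !inE eqxx ?orbT.
Qed.

Lemma region_east c : region_of (in_right c, false) = region_of (out_right c, false).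
Proof.
by apply: (@region_of_corner c [:: (in_right c, false); (out_right c, false)]);
  rewrite !inE eqxx ?orbT.
Qed.

Lemma region_south c : region_of (in_left c, false) = region_of (in_right c, true).
Proof.
by apply: (@region_of_corner c [:: (in_left c, false); (in_right c, true)]);
  rewrite !inE eqxx ?orbT.
Qed.

Lemma region_north c : region_of (out_left c, false) = region_of (out_right c, true).
Proof.
by apply: (@region_of_corner c [:: (out_left c, false); (out_right c, true)]);
  rewrite !inE eqxx ?orbT.
Qed.

Lemma boundary_cycle (R : zmodType) (phi : region D -> R) c :
  boundary phi (in_left c) + boundary phi (in_right c) =
  boundary phi (out_left c) + boundary phi (out_right c).
Proof.
rewrite /boundary region_west region_south region_north region_east.
by rewrite !addrA !subrK.
Qed.

Section Connected.
Hypothesis hconn : connected_diagram D.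

Lemma regions_connected (T : Type) (phi : region D -> T) s t :
  (forall a, phi (region_of (a, true)) = phi (region_of (a, false))) ->
  phi (region_of s) = phi (region_of t).
Proof.
move=> H.
have left_side (s0 : side D) : phi (region_of s0) = phi (region_of (s0.1, true)).
  by case: s0 => a [] //=; rewrite H.
rewrite (left_side s) (left_side t).
apply: (connect_invariant _ (hconn s.1 t.1)
  (P := fun a => phi (region_of (a, true)))) => a1 a2 /existsP[c /andP[]].
have west a : a \in [:: in_left c; in_right c; out_left c; out_right c] ->
    phi (region_of (a, true)) = phi (region_of (in_left c, true)).
  rewrite !inE => /or4P[] /eqP -> //.
  - by rewrite -region_south -H.
  - by rewrite region_west.
  - by rewrite -region_north -H region_west.
by move=> /west -> /west ->.
Qed.

Lemma crossings_connected (T : Type) (g : crossing D -> T) c c' :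
  (forall x y, inn x = out y -> g x.1 = g y.1) -> g c = g c'.
Proof.
(* [h] carries [g] over to arcs by looking at the crossing where an arc arrives; the default [g c]
   concerns only arcs that arrive at no crossing. *)
move=> H; pose h a := oapp (fun x => g x.1) (g c) [pick x | inn x == a].
have h_inn x : h (inn x) = g x.1.
  rewrite /h; case: pickP => [y /eqP/inn_inj -> //|/(_ x)].
  by rewrite eqxx.
have h_out x : h (out x) = g x.1.
  have : out x \in codom (@inn D) by rewrite inn_out codom_f.
  by case/codomP => y oy; rewrite oy h_inn; apply: H.
rewrite -(h_inn (c, true)) -(h_inn (c', true)).
apply: (connect_invariant _ (hconn _ _)) => a1 a2 /existsP[d /andP[]].
have at_d a : a \in [:: in_left d; in_right d; out_left d; out_right d] -> h a = g d.
  by rewrite !inE => /or4P[] /eqP ->; rewrite ?h_inn ?h_out.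
by move=> /at_d -> /at_d ->.
Qed.

(** If there is a crossing, connectedness makes every arc meet one, so [inn] is onto. If there is
    none, it leaves at most one arc, the round circle, whence the [1]. *)
Lemma card_arc_le : (#|arc D| <= maxn 1 (2 * #|crossing D|))%N.
Proof.
case: (pickP (crossing D)) => [c0 _|noc]; last first.
  apply: leq_trans (leq_maxl _ _); apply/card_le1_eqP => a b _ _.
  apply: (connect_invariant (P := id) _ (hconn b a)) => a1 a2 /existsP[c].
  by have := noc c.
apply: leq_trans (leq_maxr _ _).
rewrite mulnC -card_bool -card_prod -(card_codom (@inn_inj D)).
apply/subset_leq_card/subsetP => a _.
have end_inn c d : d \in [:: in_left c; in_right c; out_left c; out_right c] ->
    d \in codom (@inn D).
  have out_inn x : out x \in codom (@inn D) by rewrite inn_out codom_f.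
  by rewrite !inE => /or4P[] /eqP ->; rewrite ?out_inn //; apply: codom_f.
have /connectP[s] := hconn a (in_left c0).
case: s => [_ /= <-|b s /= /andP[/existsP[c /andP[+ _]] _] _]; first exact: codom_f.
exact: end_inn.
Qed.
End Connected.
End Topology.

Section Planar.
Variable D : link_diagram.
Hypotheses (hplanar : planar_diagram D) (hconn : connected_diagram D).
Implicit Types (c : crossing D) (a : arc D).

Let region_nth (i : 'I_#|regions D|) : region D := enum_val i.

Definition boundary_mx : 'M[rat]_(#|regions D|, #|arc D|) :=
  \matrix_(i, j) boundary (fun R => (R == region_nth i)%:R) (enum_val j).

Definition divergence_mx : 'M[rat]_(#|arc D|, #|crossing D|) :=
  \matrix_(j, k) let a := enum_val j in let c := enum_val k in
    (a == in_left c)%:R + (a == in_right c)%:R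
    - (a == out_left c)%:R - (a == out_right c)%:R.

Lemma mul_boundary_mx (v : 'rV_(#|regions D|)) :
  v *m boundary_mx =
  \row_j boundary (fun R => \sum_i v 0 i * (R == region_nth i)%:R) (enum_val j).
Proof.
apply/rowP => j; rewrite !mxE /boundary -sumrB; apply: eq_bigr => i _.
by rewrite mxE /boundary mulrBr.
Qed.

Lemma mul_divergence_mx (z : arc D -> rat) :
  (\row_j z (enum_val j)) *m divergence_mx =
  \row_k let c := enum_val k in
    z (in_left c) + z (in_right c) - z (out_left c) - z (out_right c).
Proof.
apply/rowP => k; rewrite !mxE /=.
rewrite -!(sum_delta_fun z) -!(sum_enum_val (fun t => z t * _)).
rewrite -big_split -!sumrB; apply: eq_bigr => j _.
by rewrite !mxE /= !mulrBr mulrDr.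
Qed.

Lemma boundary_divergence : boundary_mx *m divergence_mx = 0.
Proof.
apply/row_matrixP => i; rewrite row_mul row0.
have -> : row i boundary_mx =
    \row_j boundary (fun R => (R == region_nth i)%:R) (enum_val j).
  by apply/rowP => j; rewrite !mxE.
rewrite mul_divergence_mx; apply/rowP => k; rewrite !mxE /=.
by rewrite -addrA -opprD boundary_cycle subrr.
Qed.

(** A 2-chain with zero boundary has equal values across each arc and is therefore constant; the
    kernel is at most a line in a space of dimension C + 2. *)
Lemma rank_boundary : (#|crossing D| < \rank boundary_mx)%N.
Proof.
have kerle : (\rank (kermx boundary_mx) <= 1)%N.
  have s0 : 'I_#|regions D| by rewrite hplanar addn2; exact: ord0.
  apply: leq_trans (rank_leq_row (const_mx 1 : 'rV[rat]_(#|regions D|))).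
  apply: mxrankS; apply/rV_subP => v /sub_kermxP; rewrite mul_boundary_mx => v0.
  pose phi R := \sum_i v 0 i * (R == region_nth i)%:R.
  have phi_nth i : phi (region_nth i) = v 0 i.
    rewrite -(sum_delta_fun (fun j => v 0 j) i); apply: eq_bigr => j _.
    by rewrite (inj_eq enum_val_inj) eq_sym.
  have phi_flat a : phi (region_of (a, true)) = phi (region_of (a, false)).
    apply/eqP; rewrite -subr_eq0; move/rowP/(_ (enum_rank a)): v0.
    by rewrite !mxE enum_rankK => /eqP.
  suff -> : v = v 0 s0 *: const_mx 1 by apply: scalemx_sub.
  apply/rowP => i; rewrite !mxE mulr1 -!phi_nth /region_nth.
  have /imsetP[s _ ->] := enum_valP i; have /imsetP[t _ ->] := enum_valP s0.
  exact: regions_connected.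
rewrite mxrank_ker leq_subLR in kerle; move: (\rank _) kerle => k.
by rewrite hplanar addn2 addn1 ltnS.
Qed.

(** A function on crossings killed by the transpose agrees at both ends of every arc, hence is
    constant because the diagram is connected. *)
Lemma rank_divergence : (#|crossing D| <= (\rank divergence_mx).+1)%N.
Proof.
rewrite -mxrank_tr.
have kerle : (\rank (kermx divergence_mx^T) <= 1)%N.
  apply: leq_trans (rank_leq_row (const_mx 1 : 'rV[rat]_(#|crossing D|))).
  apply: mxrankS; apply/rV_subP => v /sub_kermxP v0.
  case: (pickP 'I_#|crossing D|) => [k0 _|no]; last first.
    by rewrite (_ : v = 0) ?sub0mx //; apply/rowP => k; have := no k.
  suff -> : v = v 0 k0 *: const_mx 1 by apply: scalemx_sub.
  apply/rowP => k; rewrite !mxE mulr1.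
  pose g c := v 0 (enum_rank c).
  rewrite -(enum_valK k) -(enum_valK k0) -!/(g _).
  apply: (crossings_connected hconn) => x y xy.
  have gE (h : crossing D * bool -> arc D) w : injective h ->
    \sum_c g c * ((h w == h (c, true))%:R + (h w == h (c, false))%:R) = g w.1.
    move=> h_inj; case: w => c b /=.
    under eq_bigr => d _ do rewrite !(inj_eq h_inj) !xpair_eqE.
    rewrite (bigD1 c) //= eqxx big1 => [|d /negPf dc]; last first.
      by rewrite eq_sym dc addr0 mulr0.
    by case: b; rewrite !eqxx /= ?addr0 ?add0r mulr1.
  apply/eqP; rewrite -subr_eq0 -(gE _ _ (@inn_inj D)) -(gE _ _ (@out_inj D)).
  rewrite -sumrB; move/rowP/(_ (enum_rank (inn x))): v0; rewrite !mxE => /eqP.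
  apply: etrans; congr (_ == 0); rewrite -sum_enum_val; apply: eq_bigr => l _.
  rewrite !mxE enum_rankK /g enum_valK -mulrBr; congr (_ * _).
  rewrite -xy /in_left /in_right /out_left /out_right.
  by case: (positive _); ring.
by rewrite mxrank_ker leq_subLR addn1 in kerle.
Qed.

(* By Euler's formula the boundaries have rank at least C + 1, while the kernel of
   the divergence has rank at most 2C - (C - 1). *)
Lemma kernel_divergence : (kermx divergence_mx <= boundary_mx)%MS.
Proof.
have sub : (boundary_mx <= kermx divergence_mx)%MS.
  exact/sub_kermxP/boundary_divergence.
rewrite -(geq_leqif (mxrank_leqif_sup sub)) mxrank_ker.
apply: leq_trans rank_boundary; rewrite leq_subLR.
apply: leq_trans (card_arc_le hconn) _; have := rank_divergence.
move: (\rank _) => k; move: #|crossing D| => n nk.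
by rewrite geq_max addnS /= mul2n -addnn -addSn leq_add2r.
Qed.

Lemma cycle_rat_boundary (z : arc D -> int) : is_cycle z ->
  exists phi : region D -> rat, forall a, (z a)%:~R = boundary phi a.
Proof.
move=> zC; pose zq a : rat := (z a)%:~R.
have /submx_trans/(_ kernel_divergence)/submxP[v vE] :
    (\row_j zq (enum_val j) <= kermx divergence_mx)%MS.
  apply/sub_kermxP; rewrite mul_divergence_mx; apply/rowP => k; rewrite !mxE /zq.
  by rewrite -addrA -opprD -!rmorphD zC subrr.
exists (fun R => \sum_i v 0 i * (R == region_nth i)%:R) => a.
move: vE; rewrite mul_boundary_mx => /rowP/(_ (enum_rank a)).
by rewrite !mxE enum_rankK.
Qed.

Lemma cycle_boundary (z : arc D -> int) : is_cycle z ->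
  exists phi : region D -> int, forall a, z a = boundary phi a.
Proof.
case/cycle_rat_boundary => phi phiE.
exists (fun R => Num.floor (phi R)) => a; apply: (@intr_inj rat).
rewrite phiE /boundary rmorphB /=.
(* Across an arc [phi] changes by an integer, so its fractional part is constant. *)
pose frac R := phi R - (Num.floor (phi R))%:~R.
suff : frac (region_of (a, true)) = frac (region_of (a, false)).
  rewrite /frac => E; apply/eqP; rewrite -subr_eq0; apply/eqP; move: E.
  move/eqP; rewrite -subr_eq0 => /eqP <-; ring.
apply: (regions_connected hconn) => {}a; rewrite /frac.
have -> : phi (region_of (a, true)) = phi (region_of (a, false)) + (z a)%:~R.
  by rewrite phiE /boundary addrC subrK.
by rewrite floorDrz ?intr_int // intrKfloor rmorphD /=; ring.
Qed.
End Planar.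

(** * The Seifert form of a special diagram *)

Section Special.
Variable D : link_diagram.
Hypotheses (hplanar : planar_diagram D) (hconn : connected_diagram D).
Hypothesis hspecial : special D.
Implicit Types (c : crossing D) (a : arc D).

Lemma in_leftE c : in_left c = inn (c, true).
Proof. by rewrite /in_left hspecial.2. Qed.

Lemma out_leftE c : out_left c = out (c, false).
Proof. by rewrite /out_left hspecial.2. Qed.

Lemma out_rightE c : out_right c = out (c, true).
Proof. by rewrite /out_right hspecial.2. Qed.

Lemma tail_south c : Defs.tail c = region_of (in_left c, false).
Proof. by rewrite in_leftE. Qed.

Lemma head_north c : Defs.head c = region_of (out_left c, false).
Proof. by rewrite region_north out_rightE. Qed.

(* The arcs leaving a crossing on the left are those arriving at the next one
   on the left: they form the Seifert circles around the west corners. *)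
Lemma sum_left_arcs (R : nmodType) (g : arc D -> R) :
  \sum_c g (out_left c) = \sum_c g (in_left c).
Proof.
have out_inj' : {in predT &, injective (@out_left D)}.
  by move=> c c' _ _; rewrite !out_leftE => /out_inj[].
have in_inj' : {in predT &, injective (@in_left D)}.
  by move=> c c' _ _; rewrite !in_leftE => /inn_inj[].
rewrite -(big_imset g out_inj') -(big_imset g in_inj') /=.
apply: eq_bigl; apply/subset_cardP; first by rewrite !card_in_imset.
apply/subsetP => _ /imsetP[c _ ->]; rewrite out_leftE.
have : out (c, false) \in codom (@inn D) by rewrite inn_out codom_f.
case/codomP => -[c' b] E; rewrite E.
by have := hspecial.1 _ _ _ _ E => /= ->; rewrite -in_leftE imset_f.
Qed.

(** For [h] the indicator of a vertex, this is the equality of in-degree and out-degree that makes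
    the Tait digraph Eulerian. *)
Lemma sum_heads_tails (R : nmodType) (h : region D -> R) :
  \sum_c h (Defs.head c) = \sum_c h (Defs.tail c).
Proof.
under eq_bigr do rewrite head_north; under [RHS]eq_bigr do rewrite tail_south.
exact: (sum_left_arcs (fun a => h (region_of (a, false)))).
Qed.

(** Both left arcs at a crossing have the west region on their left, so its value cancels and only
    the two shaded corners remain. *)
Lemma band_flow_boundary (phi : region D -> int) c :
  band_flow (boundary phi) c = phi (Defs.head c) - phi (Defs.tail c).
Proof. by rewrite /band_flow /boundary region_west -head_north -tail_south; ring. Qed.

Lemma seifert_form_boundary (phi psi : region D -> int) :
  seifert_form (boundary phi) (boundary psi) =
  - \sum_c phi (Defs.head c) * (psi (Defs.head c) - psi (Defs.tail c)).
Proof.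
(* [g] collects the terms with the value of [phi] at the west region; they cancel along the Seifert
   circles by [sum_left_arcs]. *)
pose g a := phi (region_of (a, true)) * psi (region_of (a, false)).
have -> : seifert_form (boundary phi) (boundary psi) =
    \sum_c (g (out_left c) - g (in_left c)
            - phi (Defs.head c) * (psi (Defs.head c) - psi (Defs.tail c))).
  apply: eq_bigr => c _; rewrite hspecial.2 band_flow_boundary /g /boundary.
  by rewrite region_west -head_north -tail_south; ring.
by rewrite !sumrB sum_left_arcs subrr sub0r.
Qed.

(** * The reduced Laplacian of the Tait digraph as a Seifert matrix *)

Section Tait.
Variables (Sh : {set region D}) (r : region D).
Hypotheses (hSh : tait_shading Sh) (hr : r \in Sh).

Lemma tait_connected (T : Type) (phi : region D -> T) u v :
  (forall c, phi (Defs.tail c) = phi (Defs.head c)) ->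
  u \in Sh -> v \in Sh -> phi u = phi v.
Proof.
have [Sh_regions shade Sh_ends] := hSh => H.
(* [sh a] is the shaded side of [a]. For the four arcs at a crossing it is the head or the tail,
   where [phi] agrees, so connectedness of the diagram carries over to the digraph. *)
pose sh a := if region_of (a, true) \in Sh then region_of (a, true)
             else region_of (a, false).
have sh_at c a : a \in [:: in_left c; in_right c; out_left c; out_right c] ->
    phi (sh a) = phi (Defs.head c).
  have [tS hS] := Sh_ends c; rewrite tail_south in tS; rewrite head_north in hS.
  rewrite !inE /sh => /or4P[] /eqP ->.
  - by rewrite shade tS /= -tail_south H.
  - by rewrite -region_south tS -tail_south H.
  - by rewrite shade hS /= -head_north.
  - by rewrite -region_north hS -head_north.
have sh_const a1 a2 : phi (sh a1) = phi (sh a2).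
  apply: (connect_invariant (P := phi \o sh) _ (hconn a1 a2)) => b1 b2.
  by case/existsP => c /andP[/sh_at /= -> /sh_at ->].
have shE w : w \in Sh -> exists a, w = sh a.
  move=> wS; have /imsetP[[a b] _ def_w] := subsetP Sh_regions w wS.
  exists a; rewrite def_w /sh in wS *; case: b wS {def_w} => wS; first by rewrite wS.
  by rewrite shade wS.
by move=> /shE[a ->] /shE[b ->].
Qed.

Variables (n : nat) (nu : 'I_n -> region D).
Hypotheses (nu_inj : injective nu).
Hypothesis nuP : forall u, reflect (exists i, u = nu i) ((u \in Sh) && (u != r)).

Lemma potential_expansion (R : pzRingType) (phi : region D -> R) u :
  u \in Sh -> phi r = 0 -> phi u = \sum_i phi (nu i) * (u == nu i)%:R.
Proof.
move=> uS phi0; have [u_r|ur] := eqVneq u r.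
  rewrite u_r phi0 big1 // => i _.
  have /andP[_ /negPf nr] : (nu i \in Sh) && (nu i != r) by apply/nuP; exists i.
  by rewrite eq_sym nr mulr0.
have /nuP[i ->] : (u \in Sh) && (u != r) by rewrite uS.
rewrite -(sum_delta_fun (fun j => phi (nu j)) i); apply: eq_bigr => j _.
by rewrite (inj_eq nu_inj) eq_sym.
Qed.

Definition head_mx : 'M[int]_(n, #|crossing D|) :=
  \matrix_(i, k) (Defs.head (enum_val k) == nu i)%:R.

Definition incidence_mx : 'M[int]_(n, #|crossing D|) :=
  \matrix_(i, k) ((Defs.head (enum_val k) == nu i)%:R
                - (Defs.tail (enum_val k) == nu i)%:R).

(** The in-degree Laplacian without the row and column of the root. In factored form, a change of
    basis can be absorbed into each factor separately. *)
Definition reduced_laplacian : 'M[int]_n := head_mx *m incidence_mx^T.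

Lemma reduced_laplacianE i j :
  reduced_laplacian i j = \sum_c (Defs.head c == nu i)%:R *
    ((Defs.head c == nu j)%:R - (Defs.tail c == nu j)%:R).
Proof.
by rewrite mxE -[RHS]sum_enum_val; apply: eq_bigr => k _; rewrite !mxE.
Qed.

(** Extended by 0 to the root, the coefficients form a potential with equal values at both ends of
    every edge; it is constant, so it is 0. *)
Lemma incidence_free (R : idomainType) (x : 'I_n -> R) :
  (forall c, \sum_i x i * ((Defs.head c == nu i)%:R - (Defs.tail c == nu i)%:R) = 0) ->
  forall i, x i = 0.
Proof.
move=> x0 i; pose phi u := \sum_i x i * (u == nu i)%:R.
have phi_nu j : phi (nu j) = x j.
  rewrite -(sum_delta_fun x j); apply: eq_bigr => k _.
  by rewrite (inj_eq nu_inj) eq_sym.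
have nuS j : nu j \in Sh /\ nu j != r.
  by apply/andP/nuP; exists j.
have phi_r : phi r = 0.
  by rewrite /phi big1 // => j _; rewrite eq_sym (negPf (nuS j).2) mulr0.
rewrite -phi_nu -phi_r; apply: tait_connected (nuS i).1 hr => c.
apply/eqP; rewrite eq_sym -subr_eq0 -(x0 c) /phi -sumrB; apply/eqP.
by apply: eq_bigr => j _; rewrite mulrBr.
Qed.

(** Basis cycles are boundaries of potentials. The matrix [Phi] of their values at the non-root
    vertices transforms minus the Laplacian into [V], and it is unimodular because the boundaries of
    single vertices can in turn be expanded in the given basis. *)
Lemma diagram_seifert_matrix m (V : 'M[int]_m) :
  seifert_matrix_of_diagram D V -> S_equivalent (- reduced_laplacian) V.
Proof.
case=> b [b_cycle b_basis] VE.
have [phi phiE] : exists phi : 'I_m -> region D -> int,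
    forall i, phi i r = 0 /\ forall a, b i a = boundary (phi i) a.
  have ex i : exists psi : region D -> int,
      psi r = 0 /\ forall a, b i a = boundary psi a.
    have [psi psiE] := cycle_boundary hplanar hconn (b_cycle i).
    (* Subtracting a constant does not change the boundary and normalizes the potential at the
       root. *)
    exists (fun u => psi u - psi r); split=> [|a]; first by rewrite subrr.
    by rewrite psiE /boundary; ring.
  exact: fin_all_exists ex.
have [_ _ ends] := hSh.
pose Phi : 'M[int]_(m, n) := \matrix_(i, s) phi i (nu s).
have flow_phi i c : band_flow (b i) c = phi i (Defs.head c) - phi i (Defs.tail c).
  by rewrite -band_flow_boundary /band_flow !(phiE i).2.
have Phi_head : Phi *m head_mx = \matrix_(i, k) phi i (Defs.head (enum_val k)).
  apply/matrixP => i k; rewrite [RHS]mxE (potential_expansion (ends _).2 (phiE i).1).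
  by rewrite mxE; apply: eq_bigr => s _; rewrite !mxE.
have Phi_inc : Phi *m incidence_mx = \matrix_(i, k) band_flow (b i) (enum_val k).
  apply/matrixP => i k; rewrite [RHS]mxE flow_phi.
  rewrite (potential_expansion (ends _).2 (phiE i).1).
  rewrite (potential_expansion (ends _).1 (phiE i).1) -sumrB mxE.
  by apply: eq_bigr => s _; rewrite !mxE mulrBr.
have V_Phi : V = Phi *m (- reduced_laplacian) *m Phi^T.
  rewrite /reduced_laplacian mulmxN mulNmx mulmxA Phi_head -mulmxA -trmx_mul Phi_inc.
  apply/matrixP => i j; rewrite VE !mxE.
  have -> : seifert_form (b i) (b j) = seifert_form (boundary (phi i)) (boundary (phi j)).
    apply: eq_bigr => c _; rewrite (phiE i).2.
    by rewrite /band_flow !(phiE j).2.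
  rewrite seifert_form_boundary; congr (- _); rewrite -[LHS]sum_enum_val.
  by apply: eq_bigr => k _; rewrite !mxE flow_phi.
(* [K] holds the coordinates, in the given basis, of the boundaries of the single non-root
   vertices. *)
have [K KE] : exists K : 'M[int]_(n, m), K *m (Phi *m incidence_mx) = incidence_mx.
  have ex s : exists k : 'rV[int]_m, forall c,
      (Defs.head c == nu s)%:R - (Defs.tail c == nu s)%:R =
      \sum_(i < m) k 0 i * band_flow (b i) c.
    pose psi u : int := (u == nu s)%:R.
    have [k [kE _]] := b_basis (boundary psi) (boundary_cycle psi).
    by exists k => c; rewrite -kE band_flow_boundary.
  have [k kE] := fin_all_exists ex; exists (\matrix_s k s).
  apply/matrixP => s c; rewrite Phi_inc [RHS]mxE kE mxE.
  by apply: eq_bigr => i _; rewrite !mxE.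
have KPhi : K *m Phi = 1%:M.
  apply/eqP; rewrite -subr_eq0; apply/eqP/matrixP => s t; rewrite [RHS]mxE.
  apply: (incidence_free (x := fun t => (K *m Phi - 1%:M) s t)) => c.
  have : ((K *m Phi - 1%:M) *m incidence_mx) s (enum_rank c) = 0.
    by rewrite mulmxBl -mulmxA KE mul1mx subrr mxE.
  apply: etrans; rewrite [RHS]mxE; apply: eq_bigr => i _.
  by rewrite [incidence_mx _ _]mxE enum_rankK.
(* Row [i] of this product and the [i]-th unit vector are both coordinates of the flow of [b i];
   uniqueness identifies them. *)
have PhiK : Phi *m K = 1%:M.
  apply/row_matrixP => i.
  have [k [_ k_uniq]] := b_basis (b i) (b_cycle i).
  rewrite -(k_uniq (row i (Phi *m K))) => [|c].
    apply: k_uniq => c; rewrite (bigD1 i) //= !mxE eqxx mul1r big1 ?addr0 // => j.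
    by rewrite !mxE eq_sym => /negPf ->; rewrite mul0r.
  have := congr1 (fun M : 'M_(_, _) => M i (enum_rank c)) (erefl (Phi *m incidence_mx)).
  rewrite {1}Phi_inc mxE enum_rankK => ->.
  rewrite -[X in Phi *m X]KE mulmxA Phi_inc mxE; apply: eq_bigr => j _.
  by rewrite [row _ _ _ _]mxE [X in _ * X]mxE enum_rankK.
have mn : m = n by apply/eqP; rewrite eqn_leq (mulmx1_min PhiK) (mulmx1_min KPhi).
subst m; rewrite V_Phi -{1}(trmxK Phi).
apply: S_congr; rewrite unitmx_tr.
by case/mulmx1_unit: PhiK.
Qed.
End Tait.
End Special.

(** * Comparison of the polynomials *)

Lemma sum_by_exponent (R : pzSemiRingType) (I : finType) (P : pred I) (e : I -> nat)
    (g : I -> R) (F : nat -> R) M : (forall i, P i -> (e i < M)%N) ->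
  \sum_(i | P i) g i * F (e i) =
  \sum_(m < M) (\sum_(i | P i) g i *+ (m == e i :> nat)) * F m.
Proof.
move=> eM; under [RHS]eq_bigr do rewrite big_distrl.
rewrite exchange_big; apply: eq_bigr => i Pi /=.
rewrite (bigD1 (Ordinal (eM i Pi))) //= eqxx big1 ?addr0 // => m.
by rewrite -val_eqE /= => /negPf ->; rewrite mul0r.
Qed.

(* All the signs of the monomials of a given degree on the right agree, so the
   absolute values of the coefficients are obtained by dropping the signs. *)
Lemma sum_abs_coef (I J : finType) (P : pred J) (a : I -> int) (e : I -> nat)
    (f : J -> nat) n (b : bool) : injective e ->
  \sum_i (a i)%:~R * 'X^(e i) =
    (-1) ^+ b * \sum_(j | P j) (-1) ^+ f j * 'X^((f j).*2 + n) :> {poly int} ->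
  forall (R : comPzRingType) (F : nat -> R),
  \sum_i (`|a i|)%:~R * F (e i) = \sum_(j | P j) F ((f j).*2 + n)%N.
Proof.
move=> e_inj eq_ab R F.
have coef m : \sum_i `|a i| *+ (m == e i) = \sum_(j | P j) 1 *+ (m == (f j).*2 + n)%N.
  have abs_l : `|\sum_i a i *+ (m == e i)| = \sum_i `|a i| *+ (m == e i).
    have [i /eqP mi|no] := pickP (fun i => m == e i); last first.
      by rewrite !big1 ?normr0 // => i _; rewrite no.
    rewrite (bigD1 i) // [RHS](bigD1 i) //= mi eqxx !big1 ?addr0 // => j ji;
      by rewrite (inj_eq e_inj) eq_sym (negPf ji).
  (* The exponent [m] determines [f j] as half of [m - n], and with it the sign. *)
  have sign j : (-1) ^+ f j *+ (m == (f j).*2 + n)%N =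
      (-1) ^+ (m - n)./2 * (1 *+ (m == (f j).*2 + n)%N) :> int.
    by case: eqP => [->|_]; rewrite ?mulr0 // addnK doubleK mulr1.
  have abs_r : `|\sum_(j | P j) (-1) ^+ f j *+ (m == (f j).*2 + n)%N| =
      \sum_(j | P j) 1 *+ (m == (f j).*2 + n)%N :> int.
    under eq_bigr do rewrite sign.
    rewrite -mulr_sumr normrM normrX normrN1 expr1n mul1r ger0_norm //.
    by apply: sumr_ge0 => j _; case: (_ == _).
  have eq_m : \sum_i a i *+ (m == e i) =
      (-1) ^+ b * \sum_(j | P j) (-1) ^+ f j *+ (m == (f j).*2 + n)%N.
    move/(congr1 (fun p : {poly int} => p`_m)): eq_ab.
    rewrite -[(-1) ^+ b in X in _ = X](rmorph_sign polyC) coefCM !coef_sum => eq_m.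
    transitivity (\sum_i ((a i)%:~R * 'X^(e i) : {poly int})`_m).
      apply: eq_bigr => i _.
      by rewrite -(rmorph_int polyC) coefCM coefXn intz mulr_natr.
    rewrite eq_m; congr (_ * _); apply: eq_bigr => j _.
    by rewrite -(rmorph_sign polyC) coefCM coefXn mulr_natr.
  by rewrite -abs_l eq_m normrM normrX normrN1 expr1n mul1r abs_r.
pose M := (\max_i e i + \max_(j | P j) ((f j).*2 + n)).+1%N.
rewrite (sum_by_exponent _ _ (M := M)) => [|i _]; last first.
  by rewrite ltnS (leq_trans (leq_bigmax i)) ?leq_addr.
transitivity (\sum_(j | P j) 1 * F ((f j).*2 + n)%N); last first.
  by apply: eq_bigr => j _; rewrite mul1r.
rewrite (sum_by_exponent (fun=> 1) _ (M := M)) => [|j Pj]; last first.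
  rewrite ltnS (leq_trans (@leq_bigmax_cond _ _ (fun j => (f j).*2 + n)%N _ Pj)) //.
  exact: leq_addl.
apply: eq_bigr => m _; congr (_ * _).
have := congr1 (fun z : int => z%:~R : R) (coef m); rewrite !rmorph_sum /=.
under eq_bigr do rewrite rmorphMn /=; under [in RHS]eq_bigr do rewrite rmorphMn /=.
exact.
Qed.

(** * Determinant and signature of the Laplacian *)

Section Assembly.
Local Open Scope sesquilinear_scope.
Variable D : link_diagram.
Hypotheses (hplanar : planar_diagram D) (hconn : connected_diagram D).
Hypothesis hspecial : special D.
Variables (Sh : {set region D}) (r : region D).
Hypotheses (hSh : tait_shading Sh) (hr : r \in Sh).
Variables (n : nat) (nu : 'I_n -> region D).
Hypotheses (nu_inj : injective nu).
Hypothesis nuP : forall u, reflect (exists i, u = nu i) ((u \in Sh) && (u != r)).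

Let L := reduced_laplacian nu.

(** The two sides differ by [y] times the number of edges with tail [nu i = nu j] minus the number
    with that head, and this is 0 since the digraph is Eulerian. *)
Lemma weighted_laplacian (R : comPzRingType) (x y : R) :
  \matrix_(i, j) (\sum_c
     (x * (Defs.head c == nu i)%:R - y * (Defs.tail c == nu i)%:R) *
     ((Defs.head c == nu j)%:R - (Defs.tail c == nu j)%:R)) =
  x *: map_mx intr L + y *: (map_mx intr L)^T.
Proof.
apply/matrixP => i j.
transitivity (x * (L i j)%:~R + y * (L j i)%:~R); last by rewrite !mxE.
rewrite mxE /L !reduced_laplacianE !rmorph_sum !mulr_sumr.
have /eqP := sum_heads_tails hspecial
  (fun u => y * (u == nu i)%:R * (u == nu j)%:R).
rewrite eq_sym -subr_eq0 -sumrB => /eqP balance.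
apply/eqP; rewrite -subr_eq0 -big_split -sumrB /=; apply/eqP; apply: etrans balance.
apply: eq_bigr => c _; rewrite !rmorphM !rmorphB /= !rmorph_nat; ring.
Qed.

Lemma det_weighted_laplacian (R : idomainType) (x y : R) :
  \det (x *: map_mx intr L + y *: (map_mx intr L)^T) =
  \sum_(T | spanning_tree Sh T) x ^+ iota_pos r T * y ^+ iotabar_pos r T.
Proof.
have [_ _ ends] := hSh.
rewrite -weighted_laplacian.
rewrite (matrix_tree nu_inj nuP hr (fun c => (ends c).1) (fun c => (ends c).2)).
apply: eq_bigr => T _.
by congr (_ ^+ _ * _ ^+ _); apply: eq_card => c; rewrite !inE hspecial.2.
Qed.

Lemma iota_pos_sum T : spanning_tree Sh T -> (iota_pos r T + iotabar_pos r T = n)%N.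
Proof.
have [_ _ ends] := hSh.
move/(card_tree nu_inj nuP hr (fun c => (ends c).1) (fun c => (ends c).2)) => <-.
rewrite -(cardsID [set c | int_active r T c] T).
by congr (_ + _)%N; apply: eq_card => c; rewrite !inE hspecial.2 //= andbC.
Qed.

Lemma det_laplacian_sym (R : idomainType) (x y : R) :
  \sum_(T | spanning_tree Sh T) x ^+ iota_pos r T * y ^+ iotabar_pos r T =
  \sum_(T | spanning_tree Sh T) y ^+ iota_pos r T * x ^+ iotabar_pos r T.
Proof.
rewrite -!det_weighted_laplacian -[LHS]det_tr; congr (\det _).
by rewrite linearD !linearZ /= trmxK addrC.
Qed.

(** For weights 1 and 1, [weighted_laplacian] exhibits L + L^T as the Gram matrix of the rows of the
    incidence matrix, which are independent by [incidence_free]. *)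
Lemma signature_laplacian : signature (- L + (- L)^T) = - n%:Z.
Proof.
have LL : - L + (- L)^T = - (incidence_mx nu *m (incidence_mx nu)^T).
  rewrite linearN /= -opprD; congr (- _).
  apply/matrixP => i j.
  have := congr1 (fun M : 'M[int]_n => M i j) (weighted_laplacian (1 : int) 1).
  rewrite !mxE !mul1r !intz => <-; rewrite -[LHS]sum_enum_val.
  by apply: eq_bigr => k _; rewrite !mxE !mul1r.
rewrite LL; apply: signature_negative_definite.
  by rewrite linearN /= trmx_mul trmxK.
move=> v v0; pose I : 'M[algC]_(_, _) := map_mx intr (incidence_mx nu).
have IC : I^t* = map_mx intr (incidence_mx nu)^T.
  by apply/matrixP => i j; rewrite !mxE rmorph_int.
have -> : map_mx intr (- (incidence_mx nu *m (incidence_mx nu)^T)) = - (I *m I^t*).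
  by rewrite raddfN /= map_mxM IC.
rewrite mulmxN mulNmx mxE oppr_lt0 mulmxA -mulmxA.
have -> : I^t* *m v^t* = (v *m I)^t* by rewrite trmx_mul map_mxM.
rewrite mxE lt_neqAle sumr_ge0 ?andbT => [|k _]; last by rewrite !mxE mul_conjC_ge0.
rewrite eq_sym; apply: contra v0; rewrite psumr_eq0 => [|k _]; last first.
  by rewrite !mxE mul_conjC_ge0.
move/allP => vI0; apply/eqP/rowP => i; rewrite mxE.
apply: (incidence_free hconn hspecial hSh hr nu_inj nuP (x := fun i => v 0 i)) => c.
have := vI0 (enum_rank c) (mem_index_enum _).
rewrite [X in _ * X]mxE [X in _ * X^*]mxE mul_conjC_eq0 => /eqP; apply: etrans.
rewrite mxE; apply: eq_bigr => j _.
by rewrite !mxE enum_rankK rmorphB /= !rmorph_nat.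
Qed.

Lemma alexander_det_laplacian : alexander_det (- L) =
  \sum_(T | spanning_tree Sh T) (- sqrt_t) ^+ iota_pos r T * sqrt_t ^- iotabar_pos r T.
Proof.
under eq_bigr do rewrite -exprVn.
rewrite -det_weighted_laplacian alexander_detE; congr (\det _).
move: L => A; apply/matrixP => i j.
by rewrite !mxE !rmorphN /= !mulrN mulNr opprK.
Qed.
End Assembly.

Lemma seifert_matrix_laplacian (D : link_diagram) (Sh : {set region D}) (r : region D)
    n (nu : 'I_n -> region D) m (V : 'M[int]_m) :
  planar_diagram D -> connected_diagram D -> special D ->
  tait_shading Sh -> r \in Sh -> injective nu ->
  (forall u, reflect (exists i, u = nu i) ((u \in Sh) && (u != r))) ->
  seifert_matrix D V -> S_equivalent (- reduced_laplacian nu) V.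
Proof.
move=> hp hc hs hSh hr nu_inj nuP [m0 [V0 [/diagram_seifert_matrix dV eqV]]].
exact: S_trans (dV hp hc hs Sh r hSh hr n nu nu_inj nuP) eqV.
Qed.

Lemma shifted_exponent (F : fieldType) (s : F) n m k : s != 0 ->
  s ^ (k%:Z - n%:Z) * s ^+ (n + m) = s ^+ (k + m).
Proof.
move=> s0; rewrite !exprnP -expfzDr //; congr (exprz _ _).
by rewrite !PoszD addrA subrK.
Qed.

Lemma double_exponent (F : fieldType) (s : F) n i j : s != 0 ->
  s ^+ i * s ^- j * s ^+ (n + (i + j)) = s ^+ (i.*2 + n).
Proof.
move=> s0; rewrite (_ : n + (i + j) = j + (i + n))%N; last by rewrite addnC -addnA addnCA.
by rewrite exprD mulrA divfK ?expf_neq0 // -exprD addnA addnn.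
Qed.

Theorem corollary4p5 (D : link_diagram)
  (hplanar : planar_diagram D) (hconn : connected_diagram D)
  (hspecial : special D)
  (n : nat) (a : int -> int)
  (hdelta : alexander_polynomial D
     (\sum_(k < (n + n).+1) (a (k%:Z - n%:Z))%:~R * sqrt_t ^ (k%:Z - n%:Z)))
  (sigma : int) (hsigma : link_signature D sigma)
  (Sh : {set region D}) (hSh : tait_shading Sh)
  (r q : region D) (hr : r \in Sh) (hrq : adjacent_face r q) :
  let x := sqrt_x ^+ 2 in
  let y := sqrt_y ^+ 2 in
  tait_poly Sh r q x y var_z var_w = tait_poly Sh r q x y 1 1 /\
  tait_poly Sh r q x y 1 1 =
    sqrt_x ^ sigma * sqrt_y ^ sigma *
    \sum_(k < (n + n).+1)
       (`|a (k%:Z - n%:Z)|)%:~R *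
         sqrt_x ^ (k%:Z - n%:Z) * sqrt_y ^ (- (k%:Z - n%:Z)).
Proof.
have no_neg (T : {set crossing D}) (B : pred (crossing D)) :
    #|[set e in ~: T | ~~ positive e && B e]| = 0%N.
  by apply: eq_card0 => e; rewrite !inE hspecial.2 andbF.
have polyE (R : comUnitRingType) (x y z w : R) : tait_poly Sh r q x y z w =
    \sum_(T | spanning_tree Sh T) x^-1 ^+ iota_pos r T * y^-1 ^+ iotabar_pos r T.
  apply: eq_bigr => T _.
  by rewrite /eps_neg /epsbar_neg !no_neg !expr0 !mulr1 !exprVn.
move=> x y; rewrite !polyE; split=> //.
pose N := #|Sh :\ r|; pose nu : 'I_N -> region D := enum_val.
have nu_inj : injective nu := enum_val_inj.
have nuP u : reflect (exists i, u = nu i) ((u \in Sh) && (u != r)).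
  have -> : (u \in Sh) && (u != r) = (u \in Sh :\ r) by rewrite in_setD1 andbC.
  apply: (iffP idP) => [uS|[i ->]]; last exact: enum_valP.
  by exists (enum_rank_in uS u); rewrite /nu enum_rankK_in.
have lap m (V : 'M[int]_m) : seifert_matrix D V -> S_equivalent (- reduced_laplacian nu) V.
  exact: seifert_matrix_laplacian nuP.
have sigmaE : sigma = - N%:Z.
  have [m [V [/lap/signature_S_equivalent <- ->]]] := hsigma.
  exact: (signature_laplacian hconn hspecial hSh hr nu_inj nuP).
have iotaE T : spanning_tree Sh T -> (iota_pos r T + iotabar_pos r T = N)%N.
  exact: (iota_pos_sum hspecial hSh hr nu_inj nuP).
(* [b] records the sign left undetermined by the Alexander polynomial. *)
have [b deltaE] : exists b : bool,
    \sum_(k < (n + n).+1) (a (k%:Z - n%:Z))%:~R * sqrt_t ^ (k%:Z - n%:Z) =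
    (-1) ^+ b * \sum_(T | spanning_tree Sh T)
      (- sqrt_t) ^+ iota_pos r T * sqrt_t ^- iotabar_pos r T.
  have [m [V [/lap/alexander_det_S_equivalent <-]]] := hdelta.
  rewrite (alexander_det_laplacian hspecial hSh hr nu_inj nuP) => -[] ->.
    by exists false; rewrite mul1r.
  by exists true; rewrite mulN1r.
have st0 : sqrt_t != 0 by rewrite -unitfE sqrt_t_unit.
(* Multiplication by [sqrt_t ^+ (n + N)] clears all negative powers, so that coefficients can be
   compared in polynomials in t^(1/2). *)
have polyX : \sum_(k < (n + n).+1) (a (k%:Z - n%:Z))%:~R * 'X^(k + N) =
    (-1) ^+ b * \sum_(T | spanning_tree Sh T)
      (-1) ^+ iota_pos r T * 'X^((iota_pos r T).*2 + n) :> {poly int}.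
  apply/eqP; rewrite -tofrac_eq; apply/eqP; rewrite rmorphM rmorph_sign !rmorph_sum /=.
  move/(congr1 ( *%R^~ (sqrt_t ^+ (n + N)))): deltaE.
  rewrite -mulrA !mulr_suml => eq_d.
  transitivity (\sum_(k < (n + n).+1) (a (k%:Z - n%:Z))%:~R * sqrt_t ^ (k%:Z - n%:Z)
                  * sqrt_t ^+ (n + N)).
    apply: eq_bigr => k _.
    by rewrite -mulrA shifted_exponent // rmorphM rmorph_int rmorphXn.
  rewrite eq_d; congr (_ * _); apply: eq_bigr => T treeT.
  rewrite rmorphM rmorph_sign rmorphXn /= -/sqrt_t -(double_exponent _ _ (iotabar_pos r T)) //.
  by rewrite (iotaE T treeT) [(- sqrt_t) ^+ _]exprNn !mulrA.
have k_inj : injective (fun k : 'I_(n + n).+1 => k + N)%N.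
  by move=> k l /addIn/val_inj.
(* Including the factor from [sigma], a tree will receive the [x]-exponent [iota_pos - N], which is
   minus [iotabar_pos]; hence the two variables are exchanged first. *)
rewrite /= (det_laplacian_sym hspecial hSh hr nu_inj nuP).
(* [F] undoes the shift by [n + N] and substitutes x/y for t. *)
pose F (i : nat) : rat_fun4 :=
  sqrt_x ^ (i%:Z - N%:Z - n%:Z) * sqrt_y ^ (- (i%:Z - N%:Z - n%:Z)).
have absE := sum_abs_coef k_inj polyX F.
transitivity (sqrt_x ^ sigma * sqrt_y ^ sigma *
  \sum_(k < (n + n).+1) (`|a (k%:Z - n%:Z)|)%:~R * F (k + N)%N); last first.
  congr (_ * _); apply: eq_bigr => k _; rewrite /F PoszD addrK mulrA.
  by [].
rewrite absE mulr_sumr; apply: eq_bigr => T treeT.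
rewrite /F sigmaE -(iotaE T treeT).
have indet0 i : indet4 i != 0 by rewrite /indet4 tofrac_eq0 -msupp_eq0 msuppX.
have sx0 : sqrt_x != 0 := indet0 _; have sy0 : sqrt_y != 0 := indet0 _.
have inv_sq (s : rat_fun4) k : (s ^+ 2)^-1 ^+ k = s ^ (- k.*2%:Z).
  by rewrite exprVn -exprM mul2n exprnN.
rewrite !inv_sq mulrACA -!expfzDr // mulrC.
by congr (exprz _ _ * exprz _ _); rewrite -!addnn !PoszD; ring.
Qed.
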